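(* Let $T$ be a theory in a language of continuous first-order logic and let $n\ge1$. Then: (1) $T$ is $\forall_n$-axiomatizable if and only if: whenever there is an $(M,N,n)$-ultrapower sandwich and $N\models T$, then $M\models T$. (2) $T$ is $\exists_n$-axiomatizable if and only if: whenever there is an $(M,N,n)$-ultrapower sandwich and $M\models T$, then $N\models T$.
   Context: Continuous first-order logic for metric structures ($[0,1]$-valued, in the sense of Ben Yaacov–Berenstein–Henson–Usvyatsov); structures are metric structures in the fixed language, and a theory is a set of closed conditions $\sigma=0$ with $\sigma$ a sentence. A $\forall_n$-sentence is a sentence of the form $\sup_{x_1}\inf_{x_2}\cdots Q_{x_n}\theta(x_1,\dots,x_n)$ where each $x_i$ is a finite block of variables, $\theta$ is quantifier-free, and $Q=\sup$ if $n$ is odd, $Q=\inf$ if $n$ is even. $\exists_n$-sentences are defined analogously, beginning with a block of $\inf$ quantifiers. $T$ is $\forall_n$-axiomatizable (resp. $\exists_n$-axiomatizable) if the class of its models is the class of models of a set of conditions of the form $\sigma=0$ with $\sigma$ a nonnegative $\forall_n$-sentence (resp. $\exists_n$-sentence). For structures $M,N$ in the same language and $n\ge1$, an $(M,N,n)$-ultrapower sandwich is a chain of embeddings $$M\hookrightarrow N\hookrightarrow M^{\mathcal U_1}\hookrightarrow N^{\mathcal U_2}\hookrightarrow\cdots\hookrightarrow Q^{\mathcal U_{n-1}},$$ where $\mathcal U_1,\dots,\mathcal U_{n-1}$ are ultrafilters, $Q=M$ if $n$ is even and $Q=N$ if $n$ is odd, and all compositions $M^{\mathcal U_{k-1}}\hookrightarrow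 M^{\mathcal U_{k+1}}$ and $N^{\mathcal U_{k-1}}\hookrightarrow N^{\mathcal U_{k+1}}$ (including the initial ones $M\hookrightarrow M^{\mathcal U_1}$ and $N\hookrightarrow N^{\mathcal U_2}$) are the diagonal embeddings; in particular $\mathcal U_{k+1}\cong\mathcal U_{k-1}\otimes\mathcal V$ for some ultrafilter $\mathcal V$. (For $n=1$ the chain is just $M\hookrightarrow N$; for $n=2$ it is $M\hookrightarrow N\hookrightarrow M^{\mathcal U_1}$.) *)

(* Defs.v *)
From HB Require Import structures.
From mathcomp Require Import all_boot all_order all_algebra generic_quotient.
From mathcomp Require Import lra.
From mathcomp Require Import all_classical all_reals.
From mathcomp Require Import topology normedtype sequences.

Set Implicit Arguments.
Unset Strict Implicit.
Unset Printing Implicit Defensive.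

Import Order.TTheory GRing.Theory Num.Theory.
Import numFieldNormedType.Exports.
Import metricType_numDomainType.

Local Open Scope classical_set_scope.
Local Open Scope ring_scope.

(* The [Pointed] component of [Complete] makes these spaces nonempty. *)
#[short(type="completeMetricType")]
HB.structure Definition CompleteMetric (K : numFieldType) :=
  { T of Complete T & Metric K T }.

Section Syntax.
Variable R : realType.

Record modulus := Modulus {
  modulus_fun :> R -> R;
  modulus_in01 : forall e, 0 < e <= 1 -> 0 < modulus_fun e <= 1 }.

(* Constant symbols are the function symbols of arity 0. *)
Record language := Language {
  fun_sym : Type;
  fun_arity : fun_sym -> nat;
  fun_modulus : fun_sym -> modulus;
  pred_sym : Type;
  pred_arity : pred_sym -> nat;
  pred_modulus : pred_sym -> modulus }.

Definition unit_cube n : set 'rV[R]_n := [set v | forall i, 0 <= v ord0 i <= 1].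

(* A continuous function [0,1]^n -> [0,1]; the values of [conn_fun] outside the
   cube are irrelevant. *)
Record connective n := Connective {
  conn_fun :> 'rV[R]_n -> R;
  conn_continuous : {within @unit_cube n, continuous conn_fun};
  conn_in01 : forall v, unit_cube v -> 0 <= conn_fun v <= 1 }.

Variable L : language.

Inductive term :=
| Var of nat
| App (f : fun_sym L) of ('I_(fun_arity f) -> term).

Inductive formula :=
| Dist of term & term
| Pred (P : pred_sym L) of ('I_(pred_arity P) -> term)
| Conn n of connective n & ('I_n -> formula)
| Sup of nat & formula
| Inf of nat & formula.

Fixpoint occurs (x : nat) (t : term) : Prop :=
  match t with
  | Var y => x = y
  | App f ts => exists i, occurs x (ts i)
  end.

Fixpoint free_in (x : nat) (phi : formula) : Prop :=
  match phi with
  | Dist t u => occurs x t \/ occurs x u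
  | Pred P ts => exists i, occurs x (ts i)
  | Conn n u phis => exists i, free_in x (phis i)
  | Sup y psi | Inf y psi => x <> y /\ free_in x psi
  end.

Record sentence := Sentence {
  sentence_formula :> formula;
  sentence_closed : forall x, ~ free_in x sentence_formula }.

Fixpoint quantifier_free (phi : formula) : Prop :=
  match phi with
  | Dist _ _ | Pred _ _ => True
  | Conn n u phis => forall i, quantifier_free (phis i)
  | Sup _ _ | Inf _ _ => False
  end.

(* [alternating b n phi]: [phi] is [n] alternating blocks of quantifiers in
   front of a quantifier-free formula, the first one being a block of [Sup] if
   [b] is true, and of [Inf] otherwise. *)
Fixpoint alternating (b : bool) (n : nat) (phi : formula) : Prop :=
  match n with
  | 0 => quantifier_free phi
  | n'.+1 => exists (xs : seq nat) (psi : formula),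
      phi = foldr (if b then Sup else Inf) psi xs /\ alternating (~~ b) n' psi
  end.

Definition forall_sentence n (sigma : sentence) := alternating true n sigma.
Definition exists_sentence n (sigma : sentence) := alternating false n sigma.

(* The theory [T] stands for the set of conditions sigma = 0, sigma in T. *)
Definition theory := set sentence.

End Syntax.

Record mstructure (R : realType) (L : language R) := MStructure {
  carrier :> completeMetricType R;
  mdist_le1 : forall x y : carrier, mdist x y <= 1;
  fun_int : forall f : fun_sym L, ('I_(fun_arity f) -> carrier) -> carrier;
  fun_int_uc : forall (f : fun_sym L) (e : R), 0 < e <= 1 ->
    forall xs ys : 'I_(fun_arity f) -> carrier,
    (forall k, mdist (xs k) (ys k) < fun_modulus f e) ->
    mdist (fun_int xs) (fun_int ys) <= e;
  pred_int : forall P : pred_sym L, ('I_(pred_arity P) -> carrier) -> R;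
  pred_int_in01 : forall (P : pred_sym L) (xs : 'I_(pred_arity P) -> carrier),
    0 <= pred_int xs <= 1;
  pred_int_uc : forall (P : pred_sym L) (e : R), 0 < e <= 1 ->
    forall xs ys : 'I_(pred_arity P) -> carrier,
    (forall k, mdist (xs k) (ys k) < pred_modulus P e) ->
    `|pred_int xs - pred_int ys| <= e }.

Section Semantics.
Variables (R : realType) (L : language R).

Definition update (M : Type) (s : nat -> M) (x : nat) (a : M) : nat -> M :=
  fun y => if y == x then a else s y.

Fixpoint teval (M : mstructure L) (s : nat -> M) (t : term L) : M :=
  match t with
  | Var x => s x
  | App f ts => fun_int (fun k => teval s (ts k))
  end.

Fixpoint eval (M : mstructure L) (s : nat -> M) (phi : formula L) : R :=
  match phi with
  | Dist t u => mdist (teval s t) (teval s u)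
  | Pred P ts => pred_int (fun k => teval s (ts k))
  | Conn n u phis => u (\row_k eval s (phis k))
  | Sup x psi => sup (range (fun a : M => eval (update s x a) psi))
  | Inf x psi => inf (range (fun a : M => eval (update s x a) psi))
  end.

(* A sentence has the same value under all assignments. *)
Definition value (M : mstructure L) (sigma : sentence L) : R :=
  eval (fun _ => point : M) sigma.

Definition models (M : mstructure L) (T : theory L) : Prop :=
  forall sigma, T sigma -> value M sigma = 0.

Definition nonnegative (sigma : sentence L) : Prop :=
  forall M : mstructure L, 0 <= value M sigma.

Definition axiomatizable_by (C : sentence L -> Prop) (T : theory L) : Prop :=
  exists S : theory L,
    (forall sigma, S sigma -> C sigma /\ nonnegative sigma) /\
    (forall M : mstructure L, models M T <-> models M S).

Definition forall_axiomatizable n := axiomatizable_by (@forall_sentence R L n).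
Definition exists_axiomatizable n := axiomatizable_by (@exists_sentence R L n).

Record is_embedding (M N : mstructure L) (h : M -> N) : Prop := IsEmbedding {
  emb_dist : forall x y, mdist (h x) (h y) = mdist x y;
  emb_fun : forall (f : fun_sym L) (xs : 'I_(fun_arity f) -> M),
    h (fun_int xs) = fun_int (fun k => h (xs k));
  emb_pred : forall (P : pred_sym L) (xs : 'I_(pred_arity P) -> M),
    pred_int (fun k => h (xs k)) = pred_int xs }.

End Semantics.

Record ultrafilter (I : Type) := Ultrafilter {
  usets :> set_system I;
  ultra_ultra : UltraFilter usets }.
#[global] Existing Instance ultra_ultra.

Section UltraLimits.
Variables (R : realType) (I : Type) (U : ultrafilter I).

Definition ulim (u : I -> R) : R := lim (u @ usets U).

Lemma ulim_cvg (u : I -> R) :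
  (forall i, 0 <= u i <= 1) -> u @ usets U --> ulim u.
Proof.
move=> u01.
have UU : UltraFilter (u @ usets U).
  split; first exact: fmap_proper_filter.
  move=> G GF sG; rewrite predeqE => A; split; last exact: sG.
  move=> GA.
  have [//|UA] := in_ultra_setVsetC (u @^-1` A) (ultra_ultra U).
  have GnA : G (~` A) by apply: sG; rewrite /fmap /= -preimage_setC in UA *.
  by have /filter_ex [? []] : G (A `&` ~` A) by exact: filterI.
have := @segment_compact R 0 1; rewrite compact_ultra => /(_ _ UU) cp.
have [|p [_ up]] := cp.
  by apply: (@filterE _ (usets U)) => i /=; rewrite in_itv /=.
by apply/cvg_ex; exists p.
Qed.

Lemma ulim_is_cvg (u : I -> R) :
  (forall i, 0 <= u i <= 1) -> cvg (u @ usets U).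
Proof. by move=> u01; apply: cvgP (ulim_cvg u01). Qed.

Lemma ulim_eq (u : I -> R) (l : R) : u @ usets U --> l -> ulim u = l.
Proof. exact: cvg_lim. Qed.

Lemma ucvg_le (u v : I -> R) (a b : R) :
  u @ usets U --> a -> v @ usets U --> b ->
  (\forall i \near usets U, u i <= v i) -> a <= b.
Proof.
move=> ua vb uv; rewrite -subr_ge0.
apply: (cvgr_to_ge (cvgB vb ua)).
by apply: filterS uv => i /=; rewrite subr_ge0.
Qed.

Lemma ulim_le (u v : I -> R) : (forall i, 0 <= u i <= 1) ->
  (forall i, 0 <= v i <= 1) -> (\forall i \near usets U, u i <= v i) ->
  ulim u <= ulim v.
Proof.
by move=> u01 v01; apply: ucvg_le; exact: ulim_cvg.
Qed.

Lemma ulim_cst (c : R) : ulim (fun _ => c) = c.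
Proof. by apply: ulim_eq; apply: cvg_cst. Qed.

Lemma ulim_in01 (u : I -> R) : (forall i, 0 <= u i <= 1) -> 0 <= ulim u <= 1.
Proof.
move=> u01; apply/andP; split.
  rewrite -(ulim_cst 0); apply: ulim_le => //.
    by move=> _; rewrite lexx ler01.
  by apply: nearW => i; case/andP: (u01 i).
rewrite -[leRHS](ulim_cst 1); apply: ulim_le => //.
  by move=> _; rewrite lexx ler01.
by apply: nearW => i; case/andP: (u01 i).
Qed.

Lemma ulim_lt (u : I -> R) (c : R) : (forall i, 0 <= u i <= 1) ->
  ulim u < c -> \forall i \near usets U, u i < c.
Proof. by move=> u01; exact: cvgr_lt (ulim_cvg u01) c. Qed.

Lemma ulim_le_cst (u : I -> R) (c : R) : (forall i, 0 <= u i <= 1) ->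
  (\forall i \near usets U, u i <= c) -> ulim u <= c.
Proof.
move=> u01; exact: cvgr_to_le (ulim_cvg u01).
Qed.

End UltraLimits.

Section Ultraproduct.
Variables (R : realType) (L : language R) (I : Type) (U : ultrafilter I).
Variable M : I -> mstructure L.

Local Notation prod := (forall i, M i).

Definition udist (a b : prod) : R := ulim U (fun i => mdist (a i) (b i)).

Let d01 (a b : prod) i : 0 <= mdist (a i) (b i) <= 1.
Proof. by rewrite mdist_ge0 mdist_le1. Qed.

Lemma udistxx a : udist a a = 0.
Proof.
rewrite /udist; under eq_fun do rewrite mdistxx.
exact: ulim_cst.
Qed.

Lemma udist_sym a b : udist a b = udist b a.
Proof. by rewrite /udist; under eq_fun do rewrite metric_sym. Qed.

Lemma udist_triangle b a c : udist a c <= udist a b + udist b c.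
Proof.
have ab := ulim_cvg (U := U) (d01 a b); have bc := ulim_cvg (U := U) (d01 b c).
apply: (ucvg_le (ulim_cvg (U := U) (d01 a c)) (cvgD ab bc)).
by apply: nearW => i /=; apply: metric_triangle.
Qed.

Lemma udist_ge0 a b : 0 <= udist a b.
Proof. by case/andP: (@ulim_in01 R I U _ (d01 a b)). Qed.

Definition ueq : rel prod := fun a b => udist a b == 0.

Lemma ueq_refl : reflexive ueq.
Proof. by move=> a; rewrite /ueq udistxx. Qed.

Lemma ueq_sym : symmetric ueq.
Proof. by move=> a b; rewrite /ueq udist_sym. Qed.

Lemma ueq_trans : transitive ueq.
Proof.
move=> b a c /eqP ab /eqP bc; rewrite /ueq eq_le udist_ge0 andbT.
by rewrite (le_trans (udist_triangle b a c)) // ab bc addr0.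
Qed.

Canonical ueq_equiv := EquivRel ueq ueq_refl ueq_sym ueq_trans.

Definition ucarrier : Type := {eq_quot ueq_equiv}%qT.
HB.instance Definition _ := Choice.on ucarrier.
HB.instance Definition _ := Quotient.copy ucarrier {eq_quot ueq_equiv}%qT.

Definition uclass (a : prod) : ucarrier := (\pi_(ucarrier) a)%qT.

Lemma uclassP a b : uclass a = uclass b <-> udist a b = 0.
Proof.
have h : reflect (uclass a = uclass b) (ueq a b).
  by have := @EquivQuot.eqmodP _ _ _ _ ueq_equiv (defaultEncModRel _) a b.
by split=> [/h/eqP|/eqP/h].
Qed.

Lemma uclass_repr (x : ucarrier) : uclass (repr x) = x.
Proof. exact: reprK. Qed.

Definition cdist (x y : ucarrier) : R := udist (repr x) (repr y).

Lemma udist_congr a a' b b' :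
  udist a a' = 0 -> udist b b' = 0 -> udist a b = udist a' b'.
Proof.
move=> aa' bb'.
have h1 := udist_triangle a' a b; have h2 := udist_triangle b' a' b.
have h3 := udist_triangle a a' b'; have h4 := udist_triangle b a b'.
rewrite (udist_sym b' b) (udist_sym a' a) in h1 h2 h3 h4.
by apply/eqP; rewrite eq_le; apply/andP; split; lra.
Qed.

Lemma cdistE a b : cdist (uclass a) (uclass b) = udist a b.
Proof. by apply: udist_congr; apply/uclassP; rewrite uclass_repr. Qed.

Lemma cdistxx x : cdist x x = 0. Proof. exact: udistxx. Qed.

Lemma cdist_positivity x y : cdist x y = 0 -> x = y.
Proof. by move/uclassP; rewrite !uclass_repr. Qed.

Lemma cdist_sym x y : cdist x y = cdist y x. Proof. exact: udist_sym. Qed.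

Lemma cdist_triangle y x z : cdist x z <= cdist x y + cdist y z.
Proof. exact: udist_triangle. Qed.

HB.instance Definition _ := isMetric.Build R ucarrier
  cdistxx cdist_positivity cdist_sym cdist_triangle.
HB.instance Definition _ := isPointed.Build ucarrier (uclass (fun=> point)).

Lemma ucarrier_complete (F : set_system ucarrier) :
  ProperFilter F -> cauchy F -> cvg F.
Proof.
move=> FF /cauchyP Fc.
pose e k : R := 2^-1 ^+ k.
have e_gt0 k : 0 < e k by rewrite exprn_gt0 // invr_gt0.
have eS k : e k = 2 * e k.+1 by rewrite /e exprS; lra.
have e_small (d : R) : 0 < d -> exists k, e k < d.
  move=> d0; have h : (e k @[k --> \oo]) --> (0 : R).
    by apply: cvg_expr; rewrite ger0_norm ?invr_ge0 // invf_lt1 // ltr1n.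
  have hd : \forall k \near \oo, e k < d by exact: cvgr_lt h _ d0.
  by have [k] := filter_ex hd; exists k.
have [x Fx] := choice (fun k => Fc (e k) (e_gt0 k)).
have xx k : mdist (x k) (x k.+1) < 2 * e k.
  have [y []] := filter_ex (@filterI _ F _ _ _ (Fx k) (Fx k.+1)).
  rewrite !ballEmdist /= => xy x'y.
  have := metric_triangle (x k) y (x k.+1); rewrite (metric_sym y).
  by have := eS k; have := e_gt0 k.+1; lra.
pose a k : prod := repr (x k).
pose a' := fix a' k : prod := match k with
  | 0 => a 0%N
  | k'.+1 => fun i => if mdist (a' k' i) (a k'.+1 i) < 2 * e k'
                      then a k'.+1 i else a' k' i
  end.
have step k i : mdist (a' k i) (a' k.+1 i) <= 2 * e k.
  rewrite /=; case: ifPn => [/ltW //|_].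
  by rewrite mdistxx mulr_ge0 // ltW.
have eqa k : \forall i \near usets U, a' k i = a k i.
  elim: k => [|k IH]; first exact: nearW.
  have hx : \forall i \near usets U, mdist (a k i) (a k.+1 i) < 2 * e k.
    exact: ulim_lt (d01 (a k) (a k.+1)) (xx k).
  by apply: filterS2 IH hx => i /= -> ->.
have tail i k n : mdist (a' k i) (a' (k + n)%N i) <= 4 * e k - 4 * e (k + n)%N.
  elim: n => [|n IH]; first by rewrite addn0 mdistxx subrr.
  rewrite addnS (le_trans (metric_triangle _ (a' (k + n)%N i) _)) //.
  by have := step (k + n)%N i; have := eS (k + n)%N; lra.
have tail' i k n : (k <= n)%N -> mdist (a' k i) (a' n i) <= 4 * e k.
  move=> /subnKC <-; apply: le_trans (tail i k _) _.
  by have := e_gt0 (k + (n - k))%N; lra.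
have lim_a' i : exists b : M i, forall k, mdist (a' k i) b <= 4 * e k.
  have cv : cvg (a' k i @[k --> \oo]).
    apply: cauchy_cvg; apply: cauchy_exP => d d0.
    have [k ek] : exists k, e k < d / 4 by apply: e_small; rewrite divr_gt0.
    exists (a' k i); exists k => // n /= kn.
    by rewrite ballEmdist /=; have := tail' i k n kn; lra.
  exists (lim (a' k i @[k --> \oo])) => k.
  apply/ler_addgt0Pr => d d0.
  have /cvgrPdist_lt /(_ _ d0) := cv => near_d.
  have [n [/= nd kn]] :=
    filter_ex (@filterI _ \oo _ _ _ near_d (nbhs_infty_ge k)).
  rewrite (le_trans (metric_triangle _ (a' n i) _)) //.
  by rewrite lerD ?tail' // metric_sym ltW.
have [b ab] : exists b : prod, forall i k, mdist (a' k i) (b i) <= 4 * e k.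
  exists (fun i => sval (cid (lim_a' i))) => i.
  by case: (cid _).
apply/cvg_ex; exists (uclass b); apply/fcvgrPdist_lt => d d0.
have [k ek] : exists k, e k < d / 5 by apply: e_small; rewrite divr_gt0.
apply: filterS (Fx k) => y; rewrite ballEmdist /= => xy.
have bx : mdist (uclass b) (x k) <= 4 * e k.
  rewrite metric_sym -[x k]uclass_repr.
  rewrite [mdist _ _]cdistE; apply: ulim_le_cst => [i|]; first exact: d01.
  by apply: filterS (eqa k) => i /= aik; rewrite -[repr _ i]aik.
have := metric_triangle (uclass b) (x k) y.
by lra.
Qed.

HB.instance Definition _ := Uniform_isComplete.Build ucarrier ucarrier_complete.

Lemma ucarrier_mdistE a b : mdist (uclass a) (uclass b) = udist a b.
Proof. exact: cdistE. Qed.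

Lemma ucarrier_mdist_le1 (x y : ucarrier) : mdist x y <= 1.
Proof. by case/andP: (@ulim_in01 R I U _ (d01 (repr x) (repr y))). Qed.

Definition ufint (f : fun_sym L) (xs : 'I_(fun_arity f) -> ucarrier) :
    ucarrier :=
  uclass (fun i => fun_int (fun k => repr (xs k) i)).

Definition upint (P : pred_sym L) (xs : 'I_(pred_arity P) -> ucarrier) : R :=
  ulim U (fun i => pred_int (fun k => repr (xs k) i)).

Let near_args n (xs ys : 'I_n -> ucarrier) (d : R) :
  (forall k, mdist (xs k) (ys k) < d) ->
  \forall i \near usets U, forall k, mdist (repr (xs k) i) (repr (ys k) i) < d.
Proof.
move=> xy; apply: filter_forall => k.
exact: ulim_lt (d01 (repr (xs k)) (repr (ys k))) (xy k).
Qed.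

Lemma ufint_uc (f : fun_sym L) (e : R) : 0 < e <= 1 ->
  forall xs ys : 'I_(fun_arity f) -> ucarrier,
  (forall k, mdist (xs k) (ys k) < fun_modulus f e) ->
  mdist (ufint xs) (ufint ys) <= e.
Proof.
move=> e01 xs ys xy; rewrite ucarrier_mdistE.
apply: ulim_le_cst => [i|]; first by rewrite mdist_ge0 mdist_le1.
by apply: filterS (near_args xy) => i /= xyi; exact: (fun_int_uc e01 xyi).
Qed.

Lemma upint_in01 (P : pred_sym L) (xs : 'I_(pred_arity P) -> ucarrier) :
  0 <= upint xs <= 1.
Proof. by apply: ulim_in01 => i; exact: pred_int_in01. Qed.

Lemma upint_uc (P : pred_sym L) (e : R) : 0 < e <= 1 ->
  forall xs ys : 'I_(pred_arity P) -> ucarrier,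
  (forall k, mdist (xs k) (ys k) < pred_modulus P e) ->
  `|upint xs - upint ys| <= e.
Proof.
move=> e01 xs ys xy.
pose u (zs : 'I_(pred_arity P) -> ucarrier) i :=
  pred_int (fun k => repr (zs k) i).
have u01 zs i : 0 <= u zs i <= 1 by exact: pred_int_in01.
have h := cvg_norm (cvgB (ulim_cvg (U := U) (u01 xs))
  (ulim_cvg (U := U) (u01 ys))).
rewrite -[upint xs]/(ulim U (u xs)) -[upint ys]/(ulim U (u ys)).
apply: (cvgr_to_le (h _ _)).
by apply: filterS (near_args xy) => i /= xyi; exact: (pred_int_uc e01 xyi).
Qed.

Let near_class n (a : 'I_n -> prod) (d : R) : 0 < d ->
  \forall i \near usets U, forall k, mdist (repr (uclass (a k)) i) (a k i) < d.
Proof.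
move=> d0; apply: filter_forall => k.
apply: ulim_lt (d01 _ (a k)) _.
by rewrite -[ulim _ _]/(udist _ _) (uclassP _ _).1 // uclass_repr.
Qed.

Let le_all01 (x : R) : (forall e, 0 < e <= 1 -> x <= e) -> x <= 0.
Proof.
move=> h; rewrite leNgt; apply/negP => x0.
have [x1|x1] := leP x 1; last by have := h 1; lra.
by have := h (x / 2); lra.
Qed.

Lemma ufint_class (f : fun_sym L) (a : 'I_(fun_arity f) -> prod) :
  ufint (fun k => uclass (a k)) = uclass (fun i => fun_int (fun k => a k i)).
Proof.
apply/uclassP/eqP; rewrite eq_le udist_ge0 andbT; apply: le_all01 => e e01.
apply: ulim_le_cst => [i|]; first by rewrite mdist_ge0 mdist_le1.
have /andP[d0 _] := modulus_in01 (fun_modulus f) e01.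
by apply: filterS (near_class a d0) => i /= ai; exact: (fun_int_uc e01 ai).
Qed.

Lemma upint_class (P : pred_sym L) (a : 'I_(pred_arity P) -> prod) :
  upint (fun k => uclass (a k)) = ulim U (fun i => pred_int (fun k => a k i)).
Proof.
apply/eqP; rewrite -subr_eq0 -normr_eq0 eq_le normr_ge0 andbT.
apply: le_all01 => e e01.
pose u (zs : 'I_(pred_arity P) -> prod) i := pred_int (fun k => zs k i).
have u01 zs i : 0 <= u zs i <= 1 by exact: pred_int_in01.
have h := cvg_norm (cvgB
  (ulim_cvg (U := U) (u01 (fun k => repr (uclass (a k)))))
  (ulim_cvg (U := U) (u01 a))).
apply: (cvgr_to_le (h _ _)).
have /andP[d0 _] := modulus_in01 (pred_modulus P) e01.
by apply: filterS (near_class a d0) => i /= ai; exact: (pred_int_uc e01 ai).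
Qed.

Definition ultraproduct : mstructure L :=
  @MStructure R L ucarrier ucarrier_mdist_le1 ufint ufint_uc upint
    upint_in01 upint_uc.

End Ultraproduct.

Definition ultrapower (R : realType) (L : language R) (M : mstructure L)
    (I : Type) (U : ultrafilter I) : mstructure L :=
  ultraproduct U (fun=> M).

Definition upclass (R : realType) (L : language R) (M : mstructure L)
    (I : Type) (U : ultrafilter I) (a : I -> M) : ultrapower M U :=
  uclass U (M := fun=> M) a.

(* [tensor_sets U V] is the ultrafilter U (x) V, in the convention for which
   M^(U (x) V) is canonically isomorphic to (M^U)^V. *)
Definition tensor_sets (I J : Type) (U : ultrafilter I) (V : ultrafilter J) :
    set_system (I * J) :=
  [set A | usets V [set j | usets U [set i | A (i, j)]]].

(* The isomorphism of ultrafilters: they correspond under a map which is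
   injective on a large set. *)
Definition ultra_isom (I J : Type) (U : set_system I) (V : set_system J)
    (e : I -> J) : Prop :=
  (forall B, V B <-> U (e @^-1` B)) /\ (exists2 A, U A & {in A &, injective e}).

Section Sandwich.
Variables (R : realType) (L : language R) (M N : mstructure L).
Variables (I : nat -> Type) (U : forall k, ultrafilter (I k)).

Fixpoint sandwich_base (k : nat) : mstructure L :=
  match k with 0 => M | 1 => N | k'.+2 => sandwich_base k' end.

(* The structures M, N, M^U_1, N^U_2, M^U_3, ... *)
Definition sandwich_level (k : nat) : mstructure L :=
  match k with
  | 0 => M
  | 1 => N
  | k'.+2 => ultrapower (sandwich_base k') (U k'.+1)
  end.

(* For [k >= 2], this is the diagonal embedding of Q^U_(k-1) in
   (Q^U_(k-1))^V = Q^(U_(k-1) (x) V), which maps the class of (a_i) to the class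
   of (a_i)_(i,j), where U_(k+1) is identified with U_(k-1) (x) V by [e]. *)
Definition is_diagonal (k : nat) :
    (sandwich_level k -> sandwich_level k.+2) -> Prop :=
  match k return (sandwich_level k -> sandwich_level k.+2) -> Prop with
  | 0 => fun h => forall a : M, h a = upclass (U 1) (fun=> a)
  | 1 => fun h => forall a : N, h a = upclass (U 2) (fun=> a)
  | k'.+2 => fun h =>
      exists (J : Type) (V : ultrafilter J) (e : I k'.+3 -> I k'.+1 * J),
        ultra_isom (U k'.+3) (tensor_sets (U k'.+1) V) e /\
        forall a : I k'.+1 -> sandwich_base k',
          h (upclass (U k'.+1) a) =
          upclass (M := sandwich_base k') (U k'.+3) (fun i => a (e i).1)
  end.

End Sandwich.

(* The ultrafilters [sw_ultra k] for [1 <= k <= n-1] and the maps [sw_map k] for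
   [k < n] are the relevant ones, and the others are unconstrained. *)
Record sandwich (R : realType) (L : language R) (M N : mstructure L)
    (n : nat) := Sandwich {
  sw_index : nat -> Type;
  sw_ultra : forall k, ultrafilter (sw_index k);
  sw_map : forall k, sandwich_level M N sw_ultra k ->
    sandwich_level M N sw_ultra k.+1;
  sw_embedding : forall k, (k < n)%N -> is_embedding (@sw_map k);
  sw_diagonal : forall k, (k.+1 < n)%N ->
    is_diagonal (fun a => @sw_map k.+1 (@sw_map k a)) }.

(* Main.v *)
Require Import Defs.
From mathcomp Require Import all_boot all_order all_algebra.
From mathcomp Require Import all_classical all_reals.
From mathcomp Require Import topology normedtype sequences.
From mathcomp Require Import lra zify.
(* Gives [eval] and other names of [Defs] precedence over those of the
   libraries. *)
Import Defs.

(* In a sandwich the maps from level k to level k+2 are elementary, so an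
   induction on j shows that the map from level k to level k+1 does not decrease
   the values of forall_j-formulas when k + j <= n.  For k = 0 and j = n this
   gives the preservation of forall_n- and exists_n-sentences.

   Conversely, let M satisfy all forall_n-consequences of T.  Prenex formulas of
   a given shape are closed under finite maxima, so an ultraproduct of models of
   T provides N |= T whose exists_n-sentences have values at most those in M.
   The same closure property gives a map from M into an ultrapower of N which
   does not increase the values of forall_(n-1)-formulas.  A map A -> B which
   does not increase forall_(m+1)-formulas extends to B -> A^V over A, with A in
   A^V diagonally, not increasing forall_m-formulas; iterating this, with
   (P^U)^V identified with P^(U (x) V), yields a sandwich.  The exists_n case is
   the same with the two structures exchanged. *)

Set Implicit Arguments.
Unset Strict Implicit.
Unset Printing Implicit Defensive.

Import Order.TTheory GRing.Theory Num.Theory.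
Import numFieldNormedType.Exports.
Import metricType_numDomainType.

Local Open Scope classical_set_scope.
Local Open Scope ring_scope.

(** * Renaming of variables *)

Section Formulas.
Variables (R : realType) (L : language R).
Implicit Types (t : term L) (phi psi : formula L) (M : mstructure L).

Definition Quant (b : bool) : nat -> formula L -> formula L :=
  if b then @Sup R L else @Inf R L.

Lemma teval_occurs M (s s' : nat -> M) t :
  (forall x, occurs x t -> s x = s' x) -> teval s t = teval s' t.
Proof.
elim: t => [x|f ts IH] /= eqs; first exact: eqs.
by congr fun_int; apply/funext => k; apply: IH => x xk; apply: eqs; exists k.
Qed.

Lemma eval_free_in M (s s' : nat -> M) phi :
  (forall x, free_in x phi -> s x = s' x) -> eval s phi = eval s' phi.
Proof.
elim: phi s s' => [t u|P ts|n c phis IH|x psi IH|x psi IH] s s' /= eqs.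
- by congr mdist; apply: teval_occurs => x xt; apply: eqs; [left|right].
- congr pred_int; apply/funext => k; apply: teval_occurs => x xk.
  by apply: eqs; exists k.
- congr (c _); apply/rowP => k; rewrite !mxE; apply: IH => x xk.
  by apply: eqs; exists k.
- suff -> : (fun a => eval (update s x a) psi) =
            (fun a => eval (update s' x a) psi) by [].
  apply/funext => a; apply: IH => y yfree.
  by rewrite /update; case: eqP => // yx; apply: eqs; split=> // xy; apply: yx.
- suff -> : (fun a => eval (update s x a) psi) =
            (fun a => eval (update s' x a) psi) by [].
  apply/funext => a; apply: IH => y yfree.
  by rewrite /update; case: eqP => // yx; apply: eqs; split=> // xy; apply: yx.
Qed.

Lemma ord_bound n (P : 'I_n -> nat -> Prop) :
  (forall i, exists K, forall x, P i x -> (x < K)%N) ->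
  exists K, forall i x, P i x -> (x < K)%N.
Proof.
move=> /choice[K PK]; exists (\max_i K i)%N => i x /PK xK.
exact: leq_trans xK (leq_bigmax i).
Qed.

Lemma occurs_bound t : exists K, forall x, occurs x t -> (x < K)%N.
Proof.
elim: t => [x|f ts IH] /=; first by exists x.+1 => y ->.
by have [K PK] := ord_bound IH; exists K => x [i /PK].
Qed.

Lemma free_in_bound phi : exists K, forall x, free_in x phi -> (x < K)%N.
Proof.
elim: phi => [t u|P ts|n c phis IH|x psi [K PK]|x psi [K PK]] /=.
- have [K tK] := occurs_bound t; have [K' uK'] := occurs_bound u.
  by exists (maxn K K') => x [/tK|/uK']; rewrite leq_max => ->; rewrite ?orbT.
- have [K PK] := ord_bound (fun i => occurs_bound (ts i)).
  by exists K => x [i /PK].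
- by have [K PK] := ord_bound IH; exists K => x [i /PK].
- by exists K => y [_ /PK].
- by exists K => y [_ /PK].
Qed.

Fixpoint trename (r : nat -> nat) t : term L :=
  match t with
  | Var x => Var L (r x)
  | App f ts => App (fun k => trename r (ts k))
  end.

(** [c] renames the bound variables and [r] the free ones; below a binder [r] is made to follow [c]
    at the bound variable. *)
Fixpoint rename (c r : nat -> nat) phi : formula L :=
  match phi with
  | Dist t u => Dist (trename r t) (trename r u)
  | Pred P ts => Pred (fun k => trename r (ts k))
  | Conn n u phis => Conn u (fun k => rename c r (phis k))
  | Sup x psi => Sup (c x) (rename c (update r x (c x)) psi)
  | Inf x psi => Inf (c x) (rename c (update r x (c x)) psi)
  end.

Lemma teval_rename M r (s : nat -> M) t :
  teval s (trename r t) = teval (s \o r) t.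
Proof.
elim: t => [//|f ts IH] /=.
by congr fun_int; apply/funext.
Qed.

(** The condition on [r] and [c] excludes capture. Disjointness of their ranges would not survive a
    binder, where [r] is updated to agree with [c] at one point; this weaker condition does. *)
Lemma eval_rename M c r (s : nat -> M) phi : injective c ->
  (forall x y, r x = c y -> x = y) ->
  eval s (rename c r phi) = eval (s \o r) phi.
Proof.
move=> cinj.
elim: phi r s => [t u|P ts|n u phis IH|x psi IH|x psi IH] r s rc /=.
- by rewrite !teval_rename.
- by congr pred_int; apply/funext => k; rewrite teval_rename.
- by congr (u _); apply/rowP => k; rewrite !mxE IH.
- suff -> : (fun a => eval (update s (c x) a)
                              (rename c (update r x (c x)) psi)) =
            (fun a => eval (update (s \o r) x a) psi) by [].
  apply/funext => a; rewrite IH.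
    congr eval; apply/funext => y /=; rewrite /update.
    case: (eqVneq y x) => [_|yx]; first by rewrite eqxx.
    by case: eqP => // /rc xy; rewrite xy eqxx in yx.
  by move=> y z; rewrite /update; case: eqP => [-> /cinj|_ /rc].
- suff -> : (fun a => eval (update s (c x) a)
                              (rename c (update r x (c x)) psi)) =
            (fun a => eval (update (s \o r) x a) psi) by [].
  apply/funext => a; rewrite IH.
    congr eval; apply/funext => y /=; rewrite /update.
    case: (eqVneq y x) => [_|yx]; first by rewrite eqxx.
    by case: eqP => // /rc xy; rewrite xy eqxx in yx.
  by move=> y z; rewrite /update; case: eqP => [-> /cinj|_ /rc].
Qed.

Lemma rename_block b c r psi xs : exists r',
  rename c r (foldr (Quant b) psi xs) =
  foldr (Quant b) (rename c r' psi) (map c xs).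
Proof.
elim: xs r => [|x xs IH] r /=; first by exists r.
have [r' h] := IH (update r x (c x)); exists r'.
by rewrite -h /Quant; case: b {IH h}.
Qed.

Lemma rename_quantifier_free c r phi :
  quantifier_free phi -> quantifier_free (rename c r phi).
Proof. by elim: phi => //= n u phis IH h i; apply: IH. Qed.

Lemma alternatingS b n phi : alternating b n.+1 phi <->
  exists xs psi, phi = foldr (Quant b) psi xs /\ alternating (~~ b) n psi.
Proof. by case: b. Qed.

Lemma rename_alternating c r b n phi :
  alternating b n phi -> alternating b n (rename c r phi).
Proof.
elim: n b r phi => [|n IH] b r phi; first exact: rename_quantifier_free.
move=> /alternatingS[xs [psi [-> /IH h]]]; apply/alternatingS.
have [r' ->] := rename_block b c r psi xs.
by exists (map c xs), (rename c r' psi).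
Qed.

Lemma quantifier_free_alternating b n phi :
  quantifier_free phi -> alternating b n phi.
Proof.
elim: n b => [//|n IH] b qf; apply/alternatingS; exists [::], phi.
by split=> //; apply: IH.
Qed.

(** The bound variables are moved beyond [Z] and beyond the finitely many values of [f] that matter,
    so nothing is captured. *)
Lemma substitution phi (f : nat -> nat) (Z : nat) : exists c r,
  (forall x, Z <= c x)%N /\
  forall M (s : nat -> M), eval s (rename c r phi) = eval (s \o f) phi.
Proof.
have [K fK] := free_in_bound phi.
pose Z' := maxn Z (\max_(x < K) f x).+1.
(* Variables from [K] on are not free in [phi]; sending them to 0 keeps the range of [r] below
   [Z']. *)
pose r x := if (x < K)%N then f x else 0%N.
have rZ' x : (r x < Z')%N.
  rewrite /r /Z' leq_max !ltnS; case: ifP => xK; last by rewrite orbT.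
  by rewrite (leq_bigmax (Ordinal xK)) orbT.
exists (addn Z'), r; split=> [x|M s].
  by rewrite (leq_trans (leq_maxl Z (\max_(x < K) f x).+1)) // leq_addr.
rewrite eval_rename => [|x y /addnI //|x y rxy]; last first.
  by have := rZ' x; rewrite rxy ltnNge leq_addr.
by apply: eval_free_in => x /fK xK; rewrite /= /r xK.
Qed.

End Formulas.

(** * Values of prenex formulas *)

Section Values.
Variables (R : realType) (L : language R).
Implicit Types (phi psi : formula L) (M : mstructure L).

(** A bound approached up to every [e]: this form treats both quantifiers alike and passes to
    ultralimits. *)
Definition is_extremum (b : bool) (E : set R) (v : R) : Prop :=
  if b then (forall x, E x -> x <= v) /\
    (forall e, 0 < e -> exists2 x, E x & v - e < x)
  else (forall x, E x -> v <= x) /\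
    (forall e, 0 < e -> exists2 x, E x & x < v + e).

Lemma extremum_unique b (E : set R) v w :
  is_extremum b E v -> is_extremum b E w -> v = w.
Proof.
case: b => -[v1 v2] [w1 w2]; apply/eqP; rewrite eq_le; apply/andP; split;
  apply/ler_addgt0Pr => e e0.
- by have [x /w1] := v2 e e0; lra.
- by have [x /v1] := w2 e e0; lra.
- by have [x /v1] := w2 e e0; lra.
- by have [x /w1] := v2 e e0; lra.
Qed.

Lemma extremum_range b (T : pointedType) (f : T -> R) :
  (forall a, 0 <= f a <= 1) ->
  is_extremum b (range f) ((if b then @sup R else @inf R) (range f)).
Proof.
move=> f01.
have f0 : range f !=set0 by exists (f point), point.
have fu : has_sup (range f).
  by split=> //; exists 1 => _ [a _ <-]; case/andP: (f01 a).
have fi : has_inf (range f).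
  by split=> //; exists 0 => _ [a _ <-]; case/andP: (f01 a).
case: b; split=> [x fx|e e0].
- exact: ub_le_sup fu.2 x fx.
- by have [x fx xe] := sup_adherent e0 fu; exists x.
- exact: ge_inf fi.2 x fx.
- by have [x fx xe] := inf_adherent e0 fi; exists x.
Qed.

Lemma extremum_in01 b (E : set R) v : is_extremum b E v ->
  (forall x, E x -> 0 <= x <= 1) -> 0 <= v <= 1.
Proof.
case: b => -[v1 v2] E01; apply/andP; split; apply/ler_addgt0Pr => e e0.
- by have [x Ex] := v2 e e0; have := E01 x Ex; have := v1 x Ex; lra.
- by have [x Ex] := v2 e e0; have := E01 x Ex; have := v1 x Ex; lra.
- by have [x Ex] := v2 e e0; have := E01 x Ex; have := v1 x Ex; lra.
- by have [x Ex] := v2 e e0; have := E01 x Ex; have := v1 x Ex; lra.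
Qed.

Lemma eval_in01 M (s : nat -> M) phi : 0 <= eval s phi <= 1.
Proof.
elim: phi s => [t u|P ts|n c phis IH|x psi IH|x psi IH] s /=.
- by rewrite mdist_ge0 mdist_le1.
- exact: pred_int_in01.
- by apply: conn_in01 => i; rewrite mxE.
- apply: (extremum_in01 (@extremum_range true _ _ _)) =>
    [a|_ [a _ <-]]; exact: IH.
- apply: (extremum_in01 (@extremum_range false _ _ _)) =>
    [a|_ [a _ <-]]; exact: IH.
Qed.

Lemma eval_Quant b M (s : nat -> M) x psi :
  is_extremum b (range (fun a => eval (update s x a) psi))
    (eval s (Quant b x psi)).
Proof.
have := @extremum_range b _ (fun a => eval (update s x a) psi)
  (fun=> eval_in01 _ _).
by case: b.
Qed.

Definition agree_off (T : Type) (xs : seq nat) (s s' : nat -> T) : Prop :=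
  forall x, x \notin xs -> s' x = s x.

(** Iterated extrema of one kind combine into a single one, the error [e] being halved at each
    variable. Prenex formulas can then be handled block by block. *)
Lemma eval_block b M (s : nat -> M) xs psi :
  is_extremum b [set eval s' psi | s' in agree_off xs s]
    (eval s (foldr (Quant b) psi xs)).
Proof.
elim: xs s => [|x xs IH] s.
  have E0 s' : agree_off [::] s s' -> s' = s.
    by move=> h; apply/funext => y; exact: h.
  by case: b; split=> [_ [s' /E0 -> <-] //|e e0 /=];
    (exists (eval s psi); [by exists s|lra]).
have off s' : agree_off (x :: xs) s s' -> agree_off xs (update s x (s' x)) s'.
  move=> h y yxs; rewrite /update; case: eqP => [->//|/eqP yx].
  by rewrite h // inE negb_or yx.
have on a s' : agree_off xs (update s x a) s' -> agree_off (x :: xs) s s'.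
  move=> h y; rewrite inE negb_or => /andP[yx /h ->].
  by rewrite /update (negbTE yx).
have := eval_Quant b s x (foldr (Quant b) psi xs).
rewrite -[Quant b x _]/(foldr (Quant b) psi (x :: xs)).
case: b IH => IH [v1 v2]; split.
- move=> _ [s' /off h <-]; apply: (le_trans _ (v1 _ _)); last by exists (s' x).
  by apply: (IH _).1; exists s'.
- move=> e e0; have [_ [a _ <-] va] := v2 _ (divr_gt0 e0 (ltr0n _ 2)).
  have [_ [s' /on h <-] w] := (IH (update s x a)).2 _ (divr_gt0 e0 (ltr0n _ 2)).
  by exists (eval s' psi); [exists s'|move: va w => /=; lra].
- move=> _ [s' /off h <-]; apply: (le_trans (v1 _ _)); first by exists (s' x).
  by apply: (IH _).1; exists s'.
- move=> e e0; have [_ [a _ <-] va] := v2 _ (divr_gt0 e0 (ltr0n _ 2)).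
  have [_ [s' /on h <-] w] := (IH (update s x a)).2 _ (divr_gt0 e0 (ltr0n _ 2)).
  by exists (eval s' psi); [exists s'|move: va w => /=; lra].
Qed.

(** The first hypothesis makes [f] nondecreasing and 1-Lipschitz, hence compatible with suprema and
    infima. This allows a block to be pulled out of a maximum. *)
Lemma eval_block_map b M (s : nat -> M) xs psi psi' (f : R -> R) :
  (forall x y, x <= y -> f x <= f y <= f x + (y - x)) ->
  (forall s', agree_off xs s s' -> eval s' psi = f (eval s' psi')) ->
  eval s (foldr (Quant b) psi xs) = f (eval s (foldr (Quant b) psi' xs)).
Proof.
move=> fmono ff; apply: extremum_unique (eval_block b s xs psi) _.
have := eval_block b s xs psi'.
case: b => -[v1 v2]; split.
- move=> _ [s' ss' <-]; rewrite ff //.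
  by have /fmono := v1 _ (ex_intro2 _ _ s' ss' erefl); lra.
- move=> e e0; have [_ [s' ss' <-] ve] := v2 e e0.
  exists (eval s' psi); [by exists s'|rewrite ff //].
  by have /fmono := v1 _ (ex_intro2 _ _ s' ss' erefl); lra.
- move=> _ [s' ss' <-]; rewrite ff //.
  by have /fmono := v1 _ (ex_intro2 _ _ s' ss' erefl); lra.
- move=> e e0; have [_ [s' ss' <-] ve] := v2 e e0.
  exists (eval s' psi); [by exists s'|rewrite ff //].
  by have /fmono := v1 _ (ex_intro2 _ _ s' ss' erefl); lra.
Qed.

(** * Connectives, and the closure of prenex formulas under them *)

Lemma coord_cvg n (v : 'rV[R]_n) (i : 'I_n) :
  (fun w : 'rV[R]_n => w ord0 i) @ v --> (v ord0 i : R).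
Proof. exact: (@coord_continuous R 1 n ord0 i v). Qed.

Lemma neg_continuous :
  {within @unit_cube R 1, continuous (fun v => 1 - v ord0 ord0)}.
Proof.
apply: continuous_subspaceT => v.
apply: (@cvgB R R^o _ (nbhs v) _ (fun=> 1) (fun w : 'rV[R]_1 => w ord0 ord0)).
  exact: (@cvg_cst R^o).
exact: coord_cvg.
Qed.

Lemma neg_in01 (v : 'rV[R]_1) : unit_cube v -> 0 <= 1 - v ord0 ord0 <= 1.
Proof. by move=> /(_ ord0); lra. Qed.

Definition neg_connective : connective R 1 :=
  Connective neg_continuous neg_in01.

Lemma zero_continuous : {within @unit_cube R 0, continuous (fun=> 0 : R)}.
Proof.
by apply: continuous_subspaceT => v; apply: (@cvg_cst R^o 0 _ (nbhs v)).
Qed.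

Lemma zero_in01 (v : 'rV[R]_0) : unit_cube v -> 0 <= (0 : R) <= 1.
Proof. by rewrite lexx ler01. Qed.

Definition zero_connective : connective R 0 :=
  Connective zero_continuous zero_in01.

Lemma max_sub_continuous (r : R) :
  {within @unit_cube R 2, continuous
    (fun v => Num.max (v ord0 ord0) (v ord0 ord_max - r))}.
Proof.
apply: continuous_subspaceT => v.
apply: (@continuous_max R _ (fun v : 'rV[R]_2 => v ord0 ord0)
  (fun v : 'rV[R]_2 => v ord0 ord_max - r) v); first exact: coord_cvg.
apply: (@cvgB R R^o _ (nbhs v) _
  (fun w : 'rV[R]_2 => w ord0 ord_max) (fun=> r)).
  exact: coord_cvg.
exact: (@cvg_cst R^o).
Qed.

Lemma max_sub_in01 (r : R) (v : 'rV[R]_2) : 0 <= r -> unit_cube v ->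
  0 <= Num.max (v ord0 ord0) (v ord0 ord_max - r) <= 1.
Proof.
move=> r0 v01; have := v01 ord0; have := v01 ord_max.
by rewrite le_max ge_max; lra.
Qed.

(** On the unit cube the first coordinate is nonnegative, so the maximum already truncates the
    difference at 0. *)
Definition max_sub_connective (r : R) (r0 : 0 <= r) : connective R 2 :=
  Connective (@max_sub_continuous r) (fun v => max_sub_in01 r0).

Definition Neg phi := Conn neg_connective (fun=> phi).
(** A starting point for maxima and a default formula; it is closed because the arguments of a
    nullary connective are indexed by an empty type. *)
Definition Zero : formula L :=
  Conn zero_connective (fun=> Dist (Var L 0) (Var L 0)).

Lemma eval_Neg M (s : nat -> M) phi : eval s (Neg phi) = 1 - eval s phi.
Proof. by rewrite /= mxE. Qed.

(** Negation exchanges suprema and infima, so it can be pushed through the blocks to the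
    quantifier-free part. *)
Lemma alternating_neg b n phi : alternating b n phi ->
  exists2 phi', alternating (~~ b) n phi' &
    forall M (s : nat -> M), eval s phi' = 1 - eval s phi.
Proof.
elim: n b phi => [|n IH] b phi.
  by move=> qf; exists (Neg phi) => [//|M s]; rewrite eval_Neg.
move=> /alternatingS[xs [psi [-> /IH[psi' alt neg]]]].
exists (foldr (Quant (~~ b)) psi' xs).
  by apply/alternatingS; exists xs, psi'.
move=> M s; apply: extremum_unique (eval_block (~~ b) s xs psi') _.
have := eval_block b s xs psi.
case: b {alt} => -[v1 v2]; split.
- move=> _ [s' ss' <-]; rewrite neg.
  by have := v1 _ (ex_intro2 _ _ s' ss' erefl); lra.
- move=> e e0; have [_ [s' ss' <-] ve] := v2 e e0.
  by exists (eval s' psi'); [by exists s'|rewrite neg; lra].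
- move=> _ [s' ss' <-]; rewrite neg.
  by have := v1 _ (ex_intro2 _ _ s' ss' erefl); lra.
- move=> e e0; have [_ [s' ss' <-] ve] := v2 e e0.
  by exists (eval s' psi'); [by exists s'|rewrite neg; lra].
Qed.

(* Once the bound variables of each formula are moved away from the free
   variables of the other one, the two first blocks can be pulled out one after
   the other. *)
Lemma alternating_max_sub b n phi0 phi1 (r : R) : 0 <= r ->
  alternating b n phi0 -> alternating b n phi1 ->
  exists2 phi, alternating b n phi & forall M (s : nat -> M),
    eval s phi = Num.max (eval s phi0) (eval s phi1 - r).
Proof.
move=> r0; elim: n b phi0 phi1 => [|n IH] b phi0 phi1.
  move=> qf0 qf1.
  exists (Conn (max_sub_connective r0)
    (fun i => if i == ord0 then phi0 else phi1)).
    by move=> i /=; case: ifP.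
  by move=> M s; rewrite /= !mxE.
move=> /alternatingS[xs0 [psi0 [e0 alt0]]] /alternatingS[xs1 [psi1 [e1 alt1]]].
have [K1 K1P] := free_in_bound phi1.
have [c0 [r0' [c0K eval0]]] := substitution phi0 id K1.
have [r0'' e0'] := rename_block b c0 r0' psi0 xs0; rewrite -e0 in e0'.
set psi0' := rename c0 r0'' psi0 in e0'.
(* The bound is taken for the matrix [psi0'], in which the variables of the block pulled out first
   may be free. *)
have [K0 K0P] := free_in_bound psi0'.
have [c1 [r1' [c1K eval1]]] := substitution phi1 id K0.
have [r1'' e1'] := rename_block b c1 r1' psi1 xs1; rewrite -e1 in e1'.
set psi1' := rename c1 r1'' psi1 in e1'.
have [psi alt psiE] := IH (~~ b) psi0' psi1' (rename_alternating _ _ alt0)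
  (rename_alternating _ _ alt1).
exists (foldr (Quant b) psi (map c0 xs0 ++ map c1 xs1)).
  by apply/alternatingS; exists (map c0 xs0 ++ map c1 xs1), psi.
move=> M s; rewrite foldr_cat -{2}[s]/(s \o id) -eval0 e0'.
apply: (@eval_block_map b M s _ _ _ (fun v => Num.max v (eval s phi1 - r))).
  by move=> x y xy; rewrite !maxElt; case: ltP => h1; case: ltP => h2; lra.
move=> s0 ss0.
have -> : eval s phi1 = eval s0 phi1.
  apply: eval_free_in => x /K1P xK; rewrite ss0 //.
  by apply/mapP => -[y _ xy]; have := c0K y; rewrite -xy leqNgt xK.
rewrite -{2}[s0]/(s0 \o id) -eval1 e1'.
apply: (@eval_block_map b M s0 _ _ _
  (fun v => Num.max (eval s0 psi0') (v - r))).
  by move=> x y xy; rewrite !maxElt; case: ltP => h1; case: ltP => h2; lra.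
move=> s1 ss1; rewrite psiE; congr (Num.max _ _).
apply: eval_free_in => x /K0P xK; rewrite ss1 //.
by apply/mapP => -[y _ xy]; have := c1K y; rewrite -xy leqNgt xK.
Qed.

Lemma alternating_Zero b n : alternating b n Zero.
Proof. by apply: quantifier_free_alternating. Qed.

(** The formula is the maximum of 0 and the [phi j - r j], described by its upper bounds; [0 <= d]
    reflects the start of the iteration at [Zero]. *)
Lemma alternating_maximum b n k (phi : nat -> formula L) (r : nat -> R) :
  (forall j, alternating b n (phi j)) -> (forall j, 0 <= r j) ->
  exists2 psi, alternating b n psi & forall M (s : nat -> M) (d : R), 0 <= d ->
    (eval s psi <= d <-> forall j, (j < k)%N -> eval s (phi j) - r j <= d).
Proof.
move=> altphi r0; elim: k => [|k [psi0 alt0 psi0P]].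
  exists Zero; first exact: alternating_Zero.
  by move=> M s d d0; split.
have [psi alt psiE] := alternating_max_sub (r0 k) alt0 (altphi k).
exists psi => // M s d d0; rewrite psiE ge_max; split.
  move=> /andP[/psi0P h0 h1] j; rewrite ltnS leq_eqVlt => /predU1P[-> //|].
  exact: h0.
move=> h; apply/andP; split; last exact: h.
by apply/psi0P => // j jk; apply: h; exact: ltnW.
Qed.

Lemma free_in_block b x xs psi :
  free_in x (foldr (Quant b) psi xs) -> free_in x psi /\ x \notin xs.
Proof.
elim: xs => [//|y xs IH] /=; rewrite inE negb_or.
by case: b IH => IH /= [/eqP xy /IH[xpsi ->]]; rewrite xy.
Qed.

(** The free variables are added to the first block, which exists because [n] is positive. This
    keeps the shape, and also the value when it is the same under all assignments. *)
Lemma alternating_sentence b n phi : (0 < n)%N -> alternating b n phi ->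
  exists2 sigma : sentence L, alternating b n sigma &
    forall M v, (forall s : nat -> M, eval s phi = v) -> value M sigma = v.
Proof.
case: n => // n _ /alternatingS[xs [psi [-> alt]]].
have [K KP] := free_in_bound (foldr (Quant b) psi xs).
have closed x : ~ free_in x (foldr (Quant b) psi (iota 0 K ++ xs)).
  rewrite foldr_cat => /free_in_block[/KP xK]; rewrite mem_iota add0n.
  by rewrite xK.
exists (Sentence closed).
  by apply/alternatingS; exists (iota 0 K ++ xs), psi.
move=> M v vP.
have := eval_block b (fun=> point : M) (iota 0 K) (foldr (Quant b) psi xs).
rewrite -foldr_cat -/(value M (Sentence closed)) => /extremum_unique; apply.
by case: b {alt KP closed} vP => vP; split=> [_ [s' _ <-]|e e0];
  rewrite ?vP //; exists v; try lra; exists (fun=> point).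
Qed.

End Values.

(** * The theorem of Los *)

Section Los.
Variables (R : realType) (L : language R).

Lemma ulim_near (I : Type) (U : ultrafilter I) (u : I -> R) (e : R) :
  (forall i, 0 <= u i <= 1) -> 0 < e ->
  \forall i \near usets U, ulim U u - e < u i < ulim U u + e.
Proof.
move=> u01 e0; have cv := ulim_cvg (U := U) u01.
have lt : ulim U u < ulim U u + e by lra.
have gt : ulim U u - e < ulim U u by lra.
apply: filterS2 (cvgr_lt _ cv _ lt) (cvgr_gt _ cv _ gt) => i h1 h2.
by apply/andP; split.
Qed.

Lemma ulim_connective (I : Type) (U : ultrafilter I) n (c : connective R n)
    (f : 'I_n -> I -> R) : (forall k i, 0 <= f k i <= 1) ->
  c (\row_k ulim U (f k)) = ulim U (fun i => c (\row_k f k i)).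
Proof.
move=> f01; apply/esym/ulim_eq.
have l01 : unit_cube (\row_k ulim U (f k)).
  by move=> k; rewrite mxE; exact: ulim_in01.
have /subspace_continuousP /(_ _ l01) cont := @conn_continuous R n c.
(* [P] is a product neighbourhood of the limit row; the finitely many coordinates lie in their
   factors simultaneously on a large set. *)
move=> B /cont; rewrite /fmap /= /within /= => -[P nP PB].
have : \forall i \near usets U, forall k, P ord0 k (f k i).
  apply: filter_forall => k.
  have := nP ord0 k; rewrite mxE; exact: (ulim_cvg (U := U) (f01 k)).
apply: filterS => i Pi; apply: (PB (\row_k f k i)) => [j k|k].
  by rewrite mxE (ord1 j).
by rewrite mxE.
Qed.

Variables (I : Type) (U : ultrafilter I) (M : I -> mstructure L).

Lemma teval_ultraproduct (s : nat -> forall i, M i) t :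
  teval (M := ultraproduct U M) (fun x => uclass U (s x)) t =
  uclass U (fun i => teval (fun x => s x i) t).
Proof.
elim: t => [//|f ts IH] /=.
rewrite -(ufint_class U (fun k i => teval (fun x => s x i) (ts k))).
by congr ufint; apply/funext => k; apply: IH.
Qed.

(** In the quantifier step of [Los], [h] is the extremum of [F] factor by factor. An [a] nearly
    optimal in all factors at once remains nearly optimal in the limit. *)
Lemma extremum_ulim b (T : Type) (F : T -> I -> R) (h : I -> R) :
  (forall a i, 0 <= F a i <= 1) -> (forall i, 0 <= h i <= 1) ->
  (forall a i, if b then F a i <= h i else h i <= F a i) ->
  (forall e, 0 < e -> exists a, forall i,
    if b then h i - e < F a i else F a i < h i + e) ->
  is_extremum b (range (fun a => ulim U (F a))) (ulim U h).
Proof.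
move=> F01 h01 F1 F2; case: b F1 F2 => F1 F2; split.
- by move=> _ [a _ <-]; apply: ulim_le => //; exact: nearW.
- move=> e e0; have [a Fa] := F2 _ (divr_gt0 e0 (ltr0n _ 2)).
  exists (ulim U (F a)); first by exists a.
  have e4 : 0 < e / 4 by rewrite divr_gt0.
  have [i [/= n1 n2]] := filter_ex (filterI (@ulim_near _ U _ _ (F01 a) e4)
    (@ulim_near _ U _ _ h01 e4)).
  by have := Fa i; lra.
- by move=> _ [a _ <-]; apply: ulim_le => //; exact: nearW.
- move=> e e0; have [a Fa] := F2 _ (divr_gt0 e0 (ltr0n _ 2)).
  exists (ulim U (F a)); first by exists a.
  have e4 : 0 < e / 4 by rewrite divr_gt0.
  have [i [/= n1 n2]] := filter_ex (filterI (@ulim_near _ U _ _ (F01 a) e4)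
    (@ulim_near _ U _ _ h01 e4)).
  by have := Fa i; lra.
Qed.

Lemma Los (s : nat -> forall i, M i) phi :
  eval (M := ultraproduct U M) (fun x => uclass U (s x)) phi =
  ulim U (fun i => eval (fun x => s x i) phi).
Proof.
have quant b x psi : (forall s : nat -> forall i, M i,
    eval (M := ultraproduct U M) (fun x => uclass U (s x)) psi =
    ulim U (fun i => eval (fun x => s x i) psi)) ->
  forall s : nat -> forall i, M i,
    eval (M := ultraproduct U M) (fun x => uclass U (s x)) (Quant b x psi) =
    ulim U (fun i => eval (fun x => s x i) (Quant b x psi)).
  move=> IH {}s.
  apply: extremum_unique (eval_Quant b (M := ultraproduct U M) _ x psi) _.
  pose F (a : forall i, M i) i := eval (update (s^~ i) x (a i)) psi.
  have -> : range (fun a : ultraproduct U M =>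
      eval (M := ultraproduct U M) (update (fun x => uclass U (s x)) x a) psi) =
      range (fun a => ulim U (F a)).
    have aux a : eval (M := ultraproduct U M)
        (update (fun x => uclass U (s x)) x (uclass U a)) psi = ulim U (F a).
      have -> : update (fun x => uclass U (s x)) x (uclass U a) =
          (fun y => uclass U (update s x a y)).
        by apply/funext => y; rewrite /update; case: eqP.
      rewrite IH; congr (ulim U _); apply/funext => i; congr eval.
      by apply/funext => y; rewrite /update; case: eqP.
    apply/seteqP; split=> [_ [a _ <-]|_ [a _ <-]].
      by exists (repr a) => //; rewrite -aux uclass_repr.
    by exists (uclass U a).
  have ext i := eval_Quant b (s^~ i) x psi.
  apply: (@extremum_ulim b _ F) => [a i|i|a i|e e0].
  - exact: eval_in01.
  - exact: eval_in01.
  - have : range (fun a => eval (update (s^~ i) x a) psi) (F a i).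
      by exists (a i).
    by have := ext i; case: b {ext} => -[v _]; exact: v.
  (* Nearly optimal witnesses, one in each factor, form a single element of the product. *)
  - have h : forall i, exists a : M i, if b
        then eval (s^~ i) (Quant b x psi) - e < eval (update (s^~ i) x a) psi
        else eval (update (s^~ i) x a) psi < eval (s^~ i) (Quant b x psi) + e.
      move=> i; have := ext i.
      by case: b {ext} => -[_ v]; have [_ [a _ <-] ?] := v e e0; exists a.
    by exists (fun i => sval (cid (h i))) => i; rewrite /F; case: (cid _).
elim: phi s => [t u|P ts|n c phis IH|x psi IH|x psi IH] s.
- by rewrite /= !teval_ultraproduct; exact: ucarrier_mdistE.
- rewrite /= -(upint_class U (fun k i => teval (fun x => s x i) (ts k))).
  by congr upint; apply/funext => k; exact: teval_ultraproduct.
- rewrite /= -ulim_connective => [|k i]; last exact: eval_in01.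
  by congr (c _); apply/rowP => k; rewrite !mxE IH.
- exact: (quant true).
- exact: (quant false).
Qed.

End Los.

(** * Extension of maps to ultrapowers *)

(** An index is a finite list of requirements with a precision. Finitely many of the sets in
    question always meet; approximations valid at each index become exact along [U]. *)
Lemma finite_sets_ultrafilter (X : Type) : exists U : ultrafilter (seq X * nat),
  forall x k, usets U [set i | List.In x i.1 /\ (k <= i.2)%N].
Proof.
pose base (l : seq X) k : set (seq X * nat) :=
  [set i | (forall x, List.In x l -> List.In x i.1) /\ (k <= i.2)%N].
pose F := [set A : set (seq X * nat) | exists l k, base l k `<=` A].
have FF : ProperFilter F.
  split; first by move=> [l [k]] /(_ (l, k)); apply; split.
  split.
  - by exists [::], 0%N.
  - move=> A B [l [k lkA]] [l' [k' lkB]]; exists (l ++ l'), (maxn k k').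
    move=> i [il]; rewrite geq_max => /andP[ik ik'].
    by split; [apply: lkA|apply: lkB]; split=> // x xl; apply: il;
      apply/List.in_app_iff; [left|right].
  - by move=> A B AB [l [k lkA]]; exists l, k; apply: subset_trans AB.
have [G [UG FG]] := ultraFilterLemma FF.
exists (Ultrafilter UG) => x k; apply: FG; exists [:: x], k => i [il ik].
by split=> //; apply: il; left.
Qed.

Lemma List_In_nth (X : Type) (x0 x : X) l :
  List.In x l -> exists2 j, (j < size l)%N & nth x0 l j = x.
Proof.
elim: l => [//|y l IH] /= [->|/IH[j jl <-]]; first by exists 0%N.
by exists j.+1.
Qed.

Section Amalgamation.
Variables (R : realType) (L : language R).
Implicit Types (phi psi : formula L) (M A B : mstructure L).

Lemma le_invSn (x y : R) : (forall k, x <= y + k.+1%:R^-1) -> x <= y.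
Proof.
move=> h; rewrite leNgt; apply/negP => /ltr_add_invr[k].
by rewrite ltNge h.
Qed.

(** Read for negations, the condition says that values of the dual shape do not drop; both together
    preserve quantifier-free values. *)
Definition forall_decreasing m A B (h : A -> B) : Prop :=
  forall psi (s : nat -> A), alternating true m psi ->
    eval (h \o s) psi <= eval s psi.

Lemma forall_decreasing_exists m A B (h : A -> B) psi (s : nat -> A) :
  forall_decreasing m h -> alternating false m psi ->
  eval s psi <= eval (h \o s) psi.
Proof.
move=> hdec /alternating_neg[psi' alt' psi'E].
by have := hdec psi' s alt'; rewrite !psi'E; lra.
Qed.

Lemma eval_quantifier_free m A B (h : A -> B) phi (s : nat -> A) :
  forall_decreasing m h -> quantifier_free phi ->
  eval (h \o s) phi = eval s phi.
Proof.
move=> hdec qf; apply/eqP.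
rewrite eq_le hdec ?(forall_decreasing_exists _ hdec) //;
  exact: quantifier_free_alternating.
Qed.

Definition tuple_assignment M n (a : M) (xs : 'I_n -> M) (x : nat) : M :=
  if x is y.+1 then (if insub y is Some i then xs i else a) else a.

(** Distances, predicates and the graph condition [d(x_0, f(x_1, ..., x_n)) = 0] are
    quantifier-free, so their values are preserved. *)
Lemma forall_decreasing_embedding m A B (h : A -> B) :
  forall_decreasing m h -> is_embedding h.
Proof.
move=> hdec; split.
- move=> x y.
  exact: (@eval_quantifier_free m _ _ h (Dist (Var L 0) (Var L 1))
    (fun n => if n is 0 then x else y) hdec).
- move=> f xs; apply: mdist_positivity.
  pose s := tuple_assignment (fun_int xs) xs.
  have := @eval_quantifier_free m _ _ h
    (Dist (Var L 0) (App (fun k : 'I_(fun_arity f) => Var L k.+1))) s hdec I.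
  rewrite /=.
  have -> : (fun k : 'I_(fun_arity f) => (h \o s) k.+1) = (fun k => h (xs k)).
    by apply/funext => k; rewrite /= valK.
  have -> : (fun k : 'I_(fun_arity f) => s k.+1) = xs.
    by apply/funext => k; rewrite /= valK.
  by move=> ->; exact: mdistxx.
- move=> P xs; pose s := tuple_assignment point xs.
  have := @eval_quantifier_free m _ _ h
    (Pred (fun k : 'I_(pred_arity P) => Var L k.+1)) s hdec I.
  rewrite /=.
  have -> : (fun k : 'I_(pred_arity P) => (h \o s) k.+1) = (fun k => h (xs k)).
    by apply/funext => k; rewrite /= valK.
  have -> : (fun k : 'I_(pred_arity P) => s k.+1) = xs.
    by apply/funext => k; rewrite /= valK.
  by [].
Qed.

(* [c] prescribes the images of some elements of [B]: none for the first
   embedding of a sandwich, those in the image of [A] for the next ones. *)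
Section Step.
Variables (A B : mstructure L) (c : B -> option A) (m : nat).
Hypothesis exists_le : forall chi (s0 : nat -> A) (s : nat -> B),
  alternating false m.+1 chi ->
  (forall x, free_in x chi -> c (s x) = Some (s0 x)) ->
  eval s0 chi <= eval s chi.

Definition extends (t : B -> A) : Prop := forall b a, c b = Some a -> t b = a.

(** Taking infima of [psi] over the variables without prescribed image gives a formula to which
    [exists_le] applies; a nearly optimal assignment in [A] then defines [t]. *)
Lemma approximate_realization psi (s : nat -> B) e :
  alternating true m psi -> 0 < e ->
  exists2 t, extends t & eval (t \o s) psi <= eval s psi + e.
Proof.
move=> alt e0; have [K KP] := free_in_bound psi.
(* [r b] is a name of [b] among the relevant variables; renaming along
   [r \o s] identifies the variables with the same value. *)
have [r rP] : exists r : B -> nat, forall x, (x < K)%N -> s (r (s x)) = s x.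
  suff /choice[r rP] : forall b : B, exists y,
      (exists2 x, (x < K)%N & s x = b) -> s y = b.
    by exists r => x xK; apply: rP; exists x.
  move=> b; have [[x xK sx]|nob] := pselect (exists2 x, (x < K)%N & s x = b).
    by exists x.
  by exists 0%N.
have [c' [r' [_ psi1E]]] := substitution psi (r \o s) 0.
set psi1 := rename c' r' psi in psi1E.
have alt1 : alternating true m psi1 by exact: rename_alternating.
have [K1 K1P] := free_in_bound psi1.
pose s0 x := if c (s x) is Some a then a else point.
pose xs := [seq x <- iota 0 K1 | ~~ isSome (c (s x))].
have chi_free x : free_in x (foldr (Quant false) psi1 xs) ->
    c (s x) = Some (s0 x).
  move=> /free_in_block[/K1P xK].
  rewrite mem_filter mem_iota leq0n add0n xK !andbT negbK.
  by rewrite /s0; case: (c (s x)).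
have := @exists_le (foldr (Quant false) psi1 xs) s0 s _ chi_free.
have -> : eval s psi = eval s psi1.
  by rewrite psi1E; apply: eval_free_in => x /KP xK /=; rewrite rP.
have [h1 _] := eval_block false s xs psi1.
have [_ /(_ e e0)[_ [s' ss' <-] h2]] := eval_block false s0 xs psi1.
move=> le; have {le h1 h2} h : eval s' psi1 <= eval s psi1 + e.
  have := h1 (eval s psi1) (ex_intro2 _ _ s (fun _ _ => erefl) erefl).
  have := le (ex_intro _ xs (ex_intro _ psi1 (conj erefl alt1))).
  by move: h2; rewrite /Quant; lra.
(* Passing through the name [r b] makes the image depend on the element [b] and not on a
   variable. *)
exists (fun b => if c b is Some a then a else s' (r b)); first by move=> b a ->.
apply: le_trans h; rewrite psi1E le_eqVlt; apply/orP; left; apply/eqP.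
apply: eval_free_in => x /KP xK /=.
case cs: (c (s x)) => [a|//].
by rewrite ss' /s0 ?rP ?cs // mem_filter rP // cs.
Qed.

(** The requirements merge into one: [pickle (j, x)] gives each formula its own variables, and the
    maximum of the formulas minus their values in [B] vanishes at [s]. *)
Lemma finite_approximate_realization (l : seq (formula L * (nat -> B))) e :
  0 < e -> exists2 t, extends t & forall p, List.In p l ->
    alternating true m p.1 -> eval (t \o p.2) p.1 <= eval p.2 p.1 + e.
Proof.
move=> e0; pose p0 : formula L * (nat -> B) := (Zero L, fun=> point).
pose phi j := if `[< alternating true m (nth p0 l j).1 >] then (nth p0 l j).1
  else Zero L.
have altphi j : alternating true m (phi j).
  by rewrite /phi; case: asboolP => // _; exact: alternating_Zero.
have /choice[phi' phi'P] : forall j, exists phi', alternating true m phi' /\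
    forall M (q : nat -> M),
      eval q phi' = eval (q \o (fun x => pickle (j, x))) (phi j).
  move=> j; have [c' [r' [_ phi'E]]] :=
    substitution (phi j) (fun x => pickle (j, x)) 0.
  by exists (rename c' r' (phi j)); split=> //; exact: rename_alternating.
pose s y := if unpickle y is Some jx then (nth p0 l jx.1).2 jx.2 else point.
have sE j : s \o (fun x => pickle (j, x)) = (nth p0 l j).2.
  by apply/funext => x; rewrite /s /= pickleK.
have [psi alt psiP] := alternating_maximum (size l)
  (fun j => (phi'P j).1)
  (fun j => proj1 (andP (eval_in01 (nth p0 l j).2 (phi j)))).
have [t tc th] := approximate_realization s alt e0.
have psi0 : eval s psi <= 0.
  by apply/psiP => // j jl; rewrite (phi'P j).2 sE subrr.
exists t => // p /(List_In_nth p0)[j jl <-] altj.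
have /psiP/(_ j jl) : eval (t \o s) psi <= e by rewrite (le_trans th) // gerDr.
rewrite (phi'P j).2 -compA sE /phi asboolT // => /(_ (ltW e0)).
by rewrite lerBlDl.
Qed.

(** The coordinates of [g b] are the images of [b] under approximations indexed by finite lists and
    precisions. Errors vanish in the limit, and prescribed images hold in every coordinate. *)
Lemma amalgamation : exists (J : Type) (V : ultrafilter J)
  (g : B -> ultrapower A V),
  (forall b a, c b = Some a -> g b = upclass V (fun=> a)) /\
  forall_decreasing m g.
Proof.
have [U UP] := finite_sets_ultrafilter (formula L * (nat -> B)).
have /choice[t tP] : forall i : seq (formula L * (nat -> B)) * nat,
    exists t : B -> A, extends t /\ forall p, List.In p i.1 ->
    alternating true m p.1 ->
    eval (t \o p.2) p.1 <= eval p.2 p.1 + i.2.+1%:R^-1.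
  move=> i; have [|t tc th] := @finite_approximate_realization i.1 i.2.+1%:R^-1.
    by rewrite invr_gt0.
  by exists t.
exists _, U, (fun b => upclass U (fun i => t i b)); split.
  move=> b a cb; rewrite /upclass; congr uclass; apply/funext => i.
  exact: (tP i).1.
move=> psi s alt; apply: le_invSn => k.
rewrite (Los U (M := fun=> A) (fun x i => t i (s x))).
apply: ulim_le_cst => [i|]; first exact: eval_in01.
apply: filterS (UP (psi, s) k) => i [si ki].
rewrite (le_trans ((tP i).2 _ si alt)) // lerD2l lef_pV2 ?posrE //.
by rewrite ler_nat.
Qed.

End Step.
End Amalgamation.

(** * Iterated ultrapowers *)

Section Tensor.
Variables (R : realType) (I J : Type) (U : ultrafilter I) (V : ultrafilter J).

Lemma tensor_ultra : UltraFilter (tensor_sets U V).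
Proof.
have TF : ProperFilter (tensor_sets U V).
  split.
    by move=> /(@filter_ex _ (usets V))[j] /(@filter_ex _ (usets U))[i].
  split.
  - by apply: (@filterE _ (usets V)) => j; apply: (@filterE _ (usets U)).
  - move=> A B TA TB.
    apply: (@filterS _ (usets V)) (@filterI _ (usets V) _ _ _ TA TB).
    move=> j [Aj Bj].
    by apply: (@filterS _ (usets U)) (@filterI _ (usets U) _ _ _ Aj Bj) => i.
  - move=> A B AB; apply: (@filterS _ (usets V)) => j.
    by apply: (@filterS _ (usets U)) => i; exact: AB.
split=> // G GF TG; rewrite predeqE => A; split; last exact: TG.
move=> GA.
have [//|VnA] := in_ultra_setVsetC
  [set j | usets U [set i | A (i, j)]] (ultra_ultra V).
have GnA : G (~` A).
  apply: TG; apply: (@filterS _ (usets V)) VnA => j nA.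
  by have [|//] := in_ultra_setVsetC [set i | A (i, j)] (ultra_ultra U).
by have /filter_ex[? []] : G (A `&` ~` A) by exact: filterI.
Qed.

Definition tensor : ultrafilter (I * J) := Ultrafilter tensor_ultra.

Lemma eq_limit (a b : R) :
  (forall e, 0 < e -> exists x, a - e < x < a + e /\ b - e < x < b + e) ->
  a = b.
Proof.
move=> h; apply/eqP; rewrite eq_le.
apply/andP; split; apply/ler_addgt0Pr => e e0;
  by have [x] := h _ (divr_gt0 e0 (ltr0n _ 2)); lra.
Qed.

(** A tensor-large set has [U]-large sections over a [V]-large set of [j]; hence some [u (i, j)] is
    close to both sides. *)
Lemma ulim_tensor (u : I * J -> R) : (forall ij, 0 <= u ij <= 1) ->
  ulim tensor u = ulim V (fun j => ulim U (fun i => u (i, j))).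
Proof.
move=> u01; apply: eq_limit => e e0.
have e20 : 0 < e / 2 by rewrite divr_gt0.
have l01 j : 0 <= ulim U (fun i => u (i, j)) <= 1 by exact: ulim_in01.
have h1 : usets V [set j | usets U
    [set i | ulim tensor u - e < u (i, j) < ulim tensor u + e]].
  exact: (@ulim_near R _ tensor _ _ u01 e0).
have [j [/= h2 h3]] := filter_ex (filterI h1 (@ulim_near R _ V _ _ l01 e20)).
have [i [/= h4 h5]] := filter_ex
  (filterI h2 (@ulim_near R _ U _ _ (fun i => u01 (i, j)) e20)).
by exists (u (i, j)); split=> //; lra.
Qed.

Lemma ulim_image (p : J -> I) (u : I -> R) : (forall i, 0 <= u i <= 1) ->
  (forall A, usets U A -> usets V (p @^-1` A)) ->
  ulim V (u \o p) = ulim U u.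
Proof.
move=> u01 pU; apply: eq_limit => e e0.
have h := pU _ (@ulim_near R _ U _ _ u01 e0).
have [j [/= h1 h2]] := filter_ex
  (filterI h (@ulim_near R _ V _ _ (fun j => u01 (p j)) e0)).
by exists (u (p j)).
Qed.

End Tensor.

Section Diagonals.
Variables (R : realType) (L : language R) (M : mstructure L).

Lemma eval_upclass (I : Type) (U : ultrafilter I) (s : nat -> I -> M) phi :
  eval (fun x => upclass U (s x)) phi = ulim U (fun i => eval (s^~ i) phi).
Proof. exact: (Los U (M := fun=> M) s). Qed.

Lemma upclass_repr (I : Type) (U : ultrafilter I) (x : ultrapower M U) :
  upclass U (repr x) = x.
Proof. exact: uclass_repr. Qed.

Lemma eval_repr (I : Type) (U : ultrafilter I) (s : nat -> ultrapower M U) phi :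
  eval s phi = ulim U (fun i => eval (fun x => repr (s x) i) phi).
Proof.
rewrite -(eval_upclass U (fun x => repr (s x))); congr eval.
by apply/funext => x; rewrite upclass_repr.
Qed.

Lemma eval_diagonal (I : Type) (U : ultrafilter I) (s : nat -> M) phi :
  eval (fun x => upclass U (fun=> s x)) phi = eval s phi.
Proof. by rewrite (eval_upclass U (fun x _ => s x)) ulim_cst. Qed.

Lemma mdist_upclass (I : Type) (U : ultrafilter I) (a b : I -> M) :
  mdist (upclass U a) (upclass U b) = ulim U (fun i => mdist (a i) (b i)).
Proof. exact: ucarrier_mdistE. Qed.

Lemma mdist01 (x y : M) : 0 <= mdist x y <= 1.
Proof. by rewrite mdist_ge0 mdist_le1. Qed.

End Diagonals.

Section IteratedUltrapower.
Variables (R : realType) (L : language R) (P : mstructure L).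
Variables (I J : Type) (U : ultrafilter I) (V : ultrafilter J).

(** The canonical identification of an iterated ultrapower with one along the tensor product,
    computed on chosen representatives. *)
Definition flatten_class (x : ultrapower (ultrapower P U) V) :
    ultrapower P (tensor U V) :=
  upclass (tensor U V)
    (fun ij => repr ((repr x : J -> ultrapower P U) ij.2) ij.1).

Lemma eval_flatten_class (s : nat -> ultrapower (ultrapower P U) V) phi :
  eval (flatten_class \o s) phi = eval s phi.
Proof.
rewrite (eval_upclass (tensor U V)) ulim_tensor => [|ij]; last exact: eval_in01.
rewrite eval_repr; congr (ulim V _); apply/funext => j.
by rewrite [RHS]eval_repr.
Qed.

Lemma flatten_class_diagonal (a : I -> P) :
  flatten_class (upclass V (fun=> upclass U a)) =
  upclass (tensor U V) (fun ij => a ij.1).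
Proof.
apply: mdist_positivity; rewrite mdist_upclass ulim_tensor; last first.
  by move=> ij; exact: mdist01.
pose x := upclass V (fun=> upclass U a).
(* The representative of a constant class need not be constant; the iterated limit is the distance
   from [x] to the class of its own representative. *)
transitivity (mdist (upclass V (repr x)) x).
  rewrite {2}/x mdist_upclass; congr (ulim V _); apply/funext => j.
  rewrite -[in RHS](upclass_repr ((repr x : J -> ultrapower P U) j)).
  by rewrite mdist_upclass.
by rewrite upclass_repr mdistxx.
Qed.

End IteratedUltrapower.

(** * Construction of sandwiches *)

Section Construction.
Variables (R : realType) (L : language R).
Implicit Types (M N A B P Q : mstructure L).

(** The inverse of [h] on its image, encoded by [c], is extended to [B]. The data come before the
    hypothesis on [h], so that a recursion can use them unconditionally. *)
Lemma diagonal_extension m A B (h : A -> B) :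
  exists (J : Type) (V : ultrafilter J) (g : B -> ultrapower A V),
    forall_decreasing m.+1 h ->
    forall_decreasing m g /\ forall a, g (h a) = upclass V (fun=> a).
Proof.
have [hdec|nh] := pselect (forall_decreasing m.+1 h); last first.
  have [V _] := finite_sets_ultrafilter unit.
  by exists _, V, (fun=> point).
have hinj a a' : h a = h a' -> a = a'.
  move=> haa'; apply: mdist_positivity.
  by rewrite -(emb_dist (forall_decreasing_embedding hdec)) haa' mdistxx.
pose c b := if pselect (exists a, h a = b) is left ex
  then Some (sval (cid ex)) else None.
have cP b a : c b = Some a <-> h a = b.
  rewrite /c; case: pselect => [ex|nex].
    case: (cid ex) => a' /= ha'; split=> [[<-] //|hab].
    by congr Some; apply: hinj; rewrite ha'.
  by split=> // hab; case: nex; exists a.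
have [|J [V [g [gc gdec]]]] := @amalgamation _ _ A B c m.
  move=> chi s0 s alt cs; have -> : eval s chi = eval (h \o s0) chi.
    by apply: eval_free_in => x /cs/cP /= ->.
  exact: forall_decreasing_exists hdec alt.
exists J, V, g => _; split=> // a; apply: gc; exact/cP.
Qed.

(** Two consecutive ultrapower levels and a map between them, bundled because the types change along
    the recursion. *)
Record stage P Q := Stage {
  st_index : Type;
  st_ultra : ultrafilter st_index;
  st_index' : Type;
  st_ultra' : ultrafilter st_index';
  st_map : ultrapower P st_ultra -> ultrapower Q st_ultra' }.

Record extension P Q (s : stage P Q) := Extension {
  ex_index : Type;
  ex_ultra : ultrafilter ex_index;
  ex_map : ultrapower Q (st_ultra' s) ->
    ultrapower P (tensor (st_ultra s) ex_ultra) }.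

(** Composition with [flatten_class] brings the target back to a single ultrapower of [P], as a
    level requires. *)
Lemma extension_exists m P Q (s : stage P Q) : exists x : extension s,
  forall_decreasing m.+1 (@st_map _ _ s) ->
  forall_decreasing m (@ex_map _ _ _ x) /\
  forall a : st_index s -> P, ex_map x (st_map (upclass (st_ultra s) a)) =
    upclass (tensor (st_ultra s) (ex_ultra x)) (fun ij => a ij.1).
Proof.
have [J [V [g gP]]] := diagonal_extension m (@st_map _ _ s).
exists (@Extension _ _ s J V (fun x => flatten_class (g x))) => /gP[gdec gdiag].
split=> [psi q alt|a] /=; last by rewrite gdiag flatten_class_diagonal.
have := eval_flatten_class (g \o q) psi.
rewrite -[flatten_class (V:=V) \o _]/((fun x => flatten_class (g x)) \o q).
by move=> ->; exact: gdec.
Qed.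

Definition next_extension m P Q (s : stage P Q) : extension s :=
  sval (cid (extension_exists m s)).

Definition next_stage m P Q (s : stage P Q) : stage Q P :=
  Stage (ex_map (next_extension m s)).

Section Stages.
Variables (M N : mstructure L) (n : nat) (h0 : M -> N).
Variables (I1 : Type) (U1 : ultrafilter I1) (h1 : N -> ultrapower M U1).
Variables (I2 : Type) (U2 : ultrafilter I2).
Variable h2 : ultrapower M U1 -> ultrapower N U2.

(** [stages k] goes from level [k.+2] to level [k.+3]. Each extension costs one alternation: the map
    from level [j] is meant to be [forall_decreasing (n - j.+1)]. *)
Fixpoint stages k : stage (sandwich_base M N k) (sandwich_base M N k.+1) :=
  match k with
  | 0 => Stage h2
  | k'.+1 => next_stage (n - k'.+4) (stages k')
  end.

Definition stage_index k : Type :=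
  if k is k'.+1 then st_index (stages k') else I1.

Definition stage_ultra k : ultrafilter (stage_index k) :=
  match k return ultrafilter (stage_index k) with
  | 0 => U1
  | k'.+1 => st_ultra (stages k')
  end.

Definition stage_map k : sandwich_level M N stage_ultra k ->
    sandwich_level M N stage_ultra k.+1 :=
  match k return sandwich_level M N stage_ultra k ->
    sandwich_level M N stage_ultra k.+1 with
  | 0 => h0
  | 1 => h1
  | k'.+2 => @st_map _ _ (stages k')
  end.

Hypothesis h0_decreasing : forall_decreasing n.-1 h0.
Hypothesis h1_decreasing : (1 < n)%N -> forall_decreasing (n - 2) h1 /\
  forall a, h1 (h0 a) = upclass U1 (fun=> a).
Hypothesis h2_decreasing : (2 < n)%N -> forall_decreasing (n - 3) h2 /\
  forall a, h2 (h1 a) = upclass U2 (fun=> a).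

Lemma stages_decreasing k : (k.+2 < n)%N ->
  forall_decreasing (n - k.+3) (@st_map _ _ (stages k)).
Proof.
elim: k => [/h2_decreasing[] //|k IH] kn.
rewrite /= /next_stage /next_extension; case: (cid _) => x /= xP.
have [] // := xP; have -> : (n - k.+4).+1 = (n - k.+3)%N by lia.
by apply: IH; exact: ltnW.
Qed.

Lemma stages_diagonal k : (k.+3 < n)%N ->
  forall a : st_index (stages k) -> sandwich_base M N k,
  st_map (s := stages k.+1) (st_map (upclass (st_ultra (stages k)) a)) =
  upclass (st_ultra' (stages k.+1)) (fun ij => a ij.1).
Proof.
move=> kn; rewrite /= /next_stage /next_extension; case: (cid _) => x /= xP.
have [] // := xP; have -> : (n - k.+4).+1 = (n - k.+3)%N by lia.
by apply: stages_decreasing; exact: ltnW.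
Qed.

Lemma stage_embedding k : (k < n)%N -> is_embedding (@stage_map k).
Proof.
case: k => [|[|k]] kn.
- exact: forall_decreasing_embedding h0_decreasing.
- exact: forall_decreasing_embedding (h1_decreasing kn).1.
- exact: forall_decreasing_embedding (stages_decreasing kn).
Qed.

Lemma stage_diagonal k : (k.+1 < n)%N ->
  is_diagonal (fun a => @stage_map k.+1 (@stage_map k a)).
Proof.
case: k => [|[|k]] kn /=.
- exact: (h1_decreasing kn).2.
- exact: (h2_decreasing kn).2.
(* The later ultrafilter is a tensor product by construction, so the identification is the
   identity. *)
- exists _, (ex_ultra (next_extension (n - k.+4) (stages k))), id.
  split; last exact: stages_diagonal.
  split=> //; exists setT => //.
  exact: (@filterT _ (usets (stage_ultra k.+3))).
Qed.

Definition stage_sandwich : sandwich M N n :=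
  Sandwich stage_embedding stage_diagonal.

End Stages.

(** [h1] and [h2] are built separately because the first two levels are [M] and [N] themselves; from
    there [stages] takes over. *)
Lemma sandwich_exists n M N (h0 : M -> N) : forall_decreasing n.-1 h0 ->
  inhabited (sandwich M N n).
Proof.
move=> h0dec.
have [I1 [U1 [h1 h1P]]] := diagonal_extension (n - 2) h0.
have [I2 [U2 [h2 h2P]]] := diagonal_extension (n - 3) h1.
have h1dec : (1 < n)%N -> forall_decreasing (n - 2) h1 /\
    forall a, h1 (h0 a) = upclass U1 (fun=> a).
  move=> n1; apply: h1P; have -> : (n - 2).+1 = n.-1 by lia.
  exact: h0dec.
have h2dec : (2 < n)%N -> forall_decreasing (n - 3) h2 /\
    forall a, h2 (h1 a) = upclass U2 (fun=> a).
  move=> n2; apply: h2P; have -> : (n - 3).+1 = (n - 2)%N by lia.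
  exact: (h1dec (ltnW n2)).1.
exact: (inhabits (stage_sandwich h0dec h1dec h2dec)).
Qed.

(** Without prescribed images, [amalgamation] asks only for a comparison of formulas without free
    variables; it yields the first map of the sandwich. *)
Lemma ultrapower_sandwich n M N : (0 < n)%N ->
  (forall sigma : sentence L, alternating false n sigma ->
    value N sigma <= value M sigma) ->
  exists (I : Type) (U : ultrafilter I),
    inhabited (sandwich M (ultrapower N U) n).
Proof.
case: n => // n _ le.
have [|J [V [g [_ gdec]]]] := @amalgamation _ _ N M (fun=> None) n.
  move=> chi s0 s alt closed.
  have chi_closed x : ~ free_in x chi by move=> /closed.
  have := le (Sentence chi_closed) alt.
  rewrite /value /= (@eval_free_in _ _ N _ s0) => [|x /chi_closed //].
  by rewrite (@eval_free_in _ _ M _ s) => [|x /chi_closed //].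
by exists J, V; exact: (@sandwich_exists n.+1 _ _ g gdec).
Qed.

End Construction.

(** * Preservation and axiomatizability *)

Section Preservation.
Variables (R : realType) (L : language R).
Implicit Types (M N A B : mstructure L).

Lemma eval_embedding A B (h : A -> B) phi (s : nat -> A) :
  is_embedding h -> quantifier_free phi -> eval (h \o s) phi = eval s phi.
Proof.
move=> [hd hf hp].
have ht t : teval (h \o s) t = h (teval s t).
  by elim: t => [//|f ts IH] /=; rewrite hf; congr fun_int; apply/funext.
elim: phi => //= [t u _|P ts _|n c phis IH qf].
- by rewrite !ht hd.
- by rewrite -hp; congr pred_int; apply/funext => k; exact: ht.
- by congr (c _); apply/rowP => k; rewrite !mxE IH.
Qed.

Variables (M N : mstructure L) (n : nat) (S : sandwich M N n).

Local Notation level k := (sandwich_level M N (@sw_ultra _ _ _ _ _ S) k).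
Local Notation map k := (@sw_map _ _ _ _ _ S k).

(** Diagonal maps preserve values by [Los]. From level 2 on, the first coordinate of [e] pulls large
    sets back to large sets, so the two ultralimits agree. *)
Lemma sandwich_elementary k phi (s : nat -> level k) :
  (k.+1 < n)%N ->
  eval (fun x => map k.+1 (map k (s x))) phi = eval s phi.
Proof.
move=> /(@sw_diagonal _ _ _ _ _ S); case: k s => [|[|k]] s /=.
- by move=> diag; under eq_fun do rewrite diag; exact: eval_diagonal.
- by move=> diag; under eq_fun do rewrite diag; exact: eval_diagonal.
- move=> [J [V [e [[eU _] diag]]]].
  have -> : s = fun x => upclass (sw_ultra S k.+1) (repr (s x)).
    by apply/funext => x; rewrite upclass_repr.
  under eq_fun do rewrite diag.
  rewrite !eval_upclass.
  apply: (@ulim_image _ _ _ _ _ (fun i => (e i).1)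
    (fun i => eval (fun x => repr (s x) i) phi)) => [i|X XU].
    exact: eval_in01.
  rewrite -[_ @^-1` X]/(e @^-1` [set ij | X ij.1]) -eU.
  by apply: (@filterE _ (usets V)) => j.
Qed.

(** A nearly optimal assignment for the outer suprema is carried along the map. The rest starts with
    infima: the induction hypothesis for its negation at level [k.+1] compares it with its value two
    levels above [k], which elementarity brings back to level [k]. *)
Lemma sandwich_increasing j k psi (s : nat -> level k) :
  (k < n)%N -> (k + j <= n)%N -> alternating true j psi ->
  eval s psi <= eval (map k \o s) psi.
Proof.
elim: j k psi s => [|j IH] k psi s kn kjn.
  by move=> qf; rewrite eval_embedding //; exact: sw_embedding.
move=> /alternatingS[xs [{}psi [-> alt]]].
have [_ h1] := eval_block true s xs psi.
have [h2 _] := eval_block true (map k \o s) xs psi.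
apply/ler_addgt0Pr => e e0; have [_ [s' ss' <-] h3] := h1 e e0.
have h4 : eval (map k \o s') psi <=
    eval (map k \o s) (foldr (Quant true) psi xs).
  by apply: h2; exists (map k \o s') => // x /ss' /= ->.
suff : eval s' psi <= eval (map k \o s') psi by lra.
(* With no block left, [k.+1] may equal [n], so the embedding property of the map at level [k] is
   used instead. *)
case: j => [|j] in IH kjn alt.
  by rewrite eval_embedding //; exact: sw_embedding.
have k1n : (k.+1 < n)%N by lia.
have [psi' /(IH k.+1 psi' (map k \o s') k1n) + psi'E] :=
  alternating_neg alt.
rewrite !psi'E -(sandwich_elementary psi s' k1n).
by move=> /(_ ltac:(lia)); rewrite -compA => h; rewrite -subr_ge0; lra.
Qed.

Lemma sandwich_forall (sigma : sentence L) : (0 < n)%N ->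
  alternating true n sigma -> value M sigma <= value N sigma.
Proof.
move=> n0 alt.
have := @sandwich_increasing n 0 sigma (fun=> point) n0 (leqnn n) alt.
congr (_ <= _); apply: eval_free_in => x.
by move=> /(@sentence_closed _ _ sigma).
Qed.

Lemma sandwich_exists_le (sigma : sentence L) : (0 < n)%N ->
  alternating false n sigma -> value N sigma <= value M sigma.
Proof.
move=> n0 alt; have [phi altphi phiE] := alternating_neg alt.
have := @sandwich_increasing n 0 phi (fun=> point) n0 (leqnn n) altphi.
rewrite !phiE /value.
rewrite (@eval_free_in _ _ N (fun=> point) (map 0 \o (fun=> point))).
  by rewrite lerD2l lerN2.
by move=> x /(@sentence_closed _ _ sigma).
Qed.

End Preservation.

(** * Compactness, and models of [T] below a given structure *)

Section Compactness.
Variables (R : realType) (L : language R).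
Implicit Types (M N : mstructure L) (T : theory L) (sigma tau : sentence L).

Lemma value_eval M sigma (s : nat -> M) : value M sigma = eval s sigma.
Proof. by apply: eval_free_in => x /(@sentence_closed _ _ sigma). Qed.

Lemma value_in01 M sigma : 0 <= value M sigma <= 1.
Proof. exact: eval_in01. Qed.

Lemma value_ultraproduct (I : Type) (U : ultrafilter I) (M : I -> mstructure L)
    sigma :
  value (ultraproduct U M) sigma = ulim U (fun i => value (M i) sigma).
Proof.
rewrite (@value_eval (ultraproduct U M) _ (fun=> uclass U (fun=> point))).
by rewrite Los.
Qed.

Lemma value_ultrapower (I : Type) (U : ultrafilter I) M sigma :
  value (ultrapower M U) sigma = value M sigma.
Proof. by rewrite value_ultraproduct ulim_cst. Qed.

Lemma models_ultraproduct (I : Type) (U : ultrafilter I) (M : I -> mstructure L)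
    T :
  (forall i, models (M i) T) -> models (ultraproduct U M) T.
Proof.
move=> MT sigma sT; rewrite value_ultraproduct.
by under eq_fun do rewrite (MT _ _ sT); exact: ulim_cst.
Qed.

Lemma models_ultrapower (I : Type) (U : ultrafilter I) M T :
  models (ultrapower M U) T <-> models M T.
Proof.
by split=> MT sigma /MT; rewrite value_ultrapower.
Qed.

Variables (b : bool) (n : nat) (T : theory L) (M : mstructure L).
Hypothesis n_gt0 : (0 < n)%N.
Hypothesis M_consequences : forall sigma, alternating (~~ b) n sigma ->
  (forall N, models N T -> value N sigma = 0) -> value M sigma = 0.

(** Otherwise the maximum [psi] of the differences [tau - value M tau] exceeds [e] in all models of
    [T], so [max(0, e - psi)] vanishes there and has the dual shape; but its value in [M] is [e]. *)
Lemma finite_approximate_model (l : seq (sentence L)) e : 0 < e <= 1 ->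
  exists2 N, models N T & forall tau, List.In tau l -> alternating b n tau ->
    value N tau <= value M tau + e.
Proof.
move=> e01; apply: contrapT => noN.
pose f j := nth (Zero L) (map (@sentence_formula _ _) l) j.
pose phi j := if `[< alternating b n (f j) >] then f j else Zero L.
have altphi j : alternating b n (phi j).
  by rewrite /phi; case: asboolP => // _; exact: alternating_Zero.
have closed j x : ~ free_in x (phi j).
  have Zclosed : ~ free_in x (Zero L) by case=> -[].
  rewrite /phi; case: asboolP => // _; rewrite /f.
  elim: l j {noN f phi altphi} => [|sigma l IH] [|j] //=.
  exact: sentence_closed.
have phiE N j (s s' : nat -> N) : eval s (phi j) = eval s' (phi j).
  by apply: eval_free_in => x /closed.
have [psi alt psiP] := alternating_maximum (size l) altphi
  (fun j => proj1 (andP (eval_in01 (fun=> point : M) (phi j)))).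
have psiM (s : nat -> M) : eval s psi = 0.
  apply/eqP; rewrite eq_le; have /andP[-> _] := eval_in01 s psi; rewrite andbT.
  by apply/psiP => // j _; rewrite (phiE M j s (fun=> point)) subrr.
have psiN N (s : nat -> N) : models N T -> e < eval s psi.
  move=> NT; rewrite ltNge; apply/negP => psi_e; apply: noN; exists N => //.
  move=> tau /(@List.in_map _ _ (@sentence_formula _ _)).
  move=> /(List_In_nth (Zero L))[j].
  rewrite size_map => jl jtau altj.
  have phitau : phi j = tau by rewrite /phi /f jtau asboolT.
  have e0 : 0 <= e by lra.
  have /(_ j jl) := (psiP N s e e0).1 psi_e.
  by rewrite lerBlDl (value_eval _ s) /value -phitau.
have [psi' alt' psi'E] := alternating_neg alt.
have e1 : 0 <= 1 - e by lra.
have [chi altchi chiE] :=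
  alternating_max_sub e1 (alternating_Zero L (~~ b) n) alt'.
have [sigma altsigma sigmaE] := alternating_sentence n_gt0 altchi.
have : value M sigma = 0.
  apply: M_consequences altsigma _ => N NT; apply: sigmaE => s.
  rewrite chiE psi'E /= maxElt; case: ltP => //.
  by have := psiN N s NT; lra.
rewrite (sigmaE M e) => [|s]; first lra.
rewrite chiE psi'E psiM /= maxElt; case: ltP; lra.
Qed.

Lemma model_below : exists2 N, models N T &
  forall tau, alternating b n tau -> value N tau <= value M tau.
Proof.
have [U UP] := finite_sets_ultrafilter (sentence L).
have /choice[N NP] : forall i : seq (sentence L) * nat, exists N : mstructure L,
    models N T /\ forall tau, List.In tau i.1 -> alternating b n tau ->
    value N tau <= value M tau + i.2.+1%:R^-1.
  move=> i; have [|N NT Nle] := @finite_approximate_model i.1 i.2.+1%:R^-1.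
    by rewrite invr_gt0 ltr0n invf_le1 ?ltr0n // ler1n.
  by exists N.
exists (ultraproduct U N).
  by apply: models_ultraproduct => i; exact: (NP i).1.
move=> tau alt; apply: le_invSn => k; rewrite value_ultraproduct.
apply: ulim_le_cst => [i|]; first exact: value_in01.
apply: filterS (UP tau k) => i [taui ki].
by rewrite (le_trans ((NP i).2 _ taui alt)) // lerD2l lef_pV2 ?posrE // ler_nat.
Qed.

End Compactness.

(** The axioms are all consequences of [T] of the given shape; they are nonnegative because all
    values lie in [[0,1]]. *)
Lemma axiomatizable_sandwich (R : realType) (L : language R) (T : theory L)
    (b : bool) (n : nat) :
  (forall M : mstructure L, (forall sigma : sentence L, alternating b n sigma ->
    (forall N, models N T -> value N sigma = 0) -> value M sigma = 0) ->
    models M T) ->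
  axiomatizable_by (fun sigma : sentence L => alternating b n sigma) T.
Proof.
move=> MT; exists (fun sigma : sentence L => alternating b n sigma /\
  (forall N : mstructure L, models N T -> value N sigma = 0)).
split=> [sigma [alt _]|M].
  by split=> // M; have /andP[] := value_in01 M sigma.
split=> [MT' sigma [_]|h]; first exact.
by apply: MT => sigma alt sigma0; exact: h.
Qed.

Theorem theorem4p2 (R : realType) (L : language R) (T : theory L) (n : nat)
    (hn : (1 <= n)%N) :
  (forall_axiomatizable n T <->
     (forall M N : mstructure L, sandwich M N n -> models N T -> models M T)) /\
  (exists_axiomatizable n T <->
     (forall M N : mstructure L, sandwich M N n -> models M T -> models N T)).
Proof.
split; split.
- move=> [Ax [AxP TAx]] M N S /TAx NAx; apply/TAx => sigma sAx.
  have [alt sigma_ge0] := AxP _ sAx; apply/eqP; rewrite eq_le sigma_ge0 andbT.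
  by rewrite -(NAx _ sAx); exact: sandwich_forall S _ hn alt.
- move=> pres; apply: (@axiomatizable_sandwich _ _ _ true) => M Mcons.
  have [N NT Nle] := @model_below _ _ false n T M hn Mcons.
  have [I [U [S]]] := ultrapower_sandwich hn Nle.
  by apply: pres S _; exact/models_ultrapower.
- move=> [Ax [AxP TAx]] M N S /TAx MAx; apply/TAx => sigma sAx.
  have [alt sigma_ge0] := AxP _ sAx; apply/eqP; rewrite eq_le sigma_ge0 andbT.
  by rewrite -(MAx _ sAx); exact: sandwich_exists_le S _ hn alt.
- move=> pres; apply: (@axiomatizable_sandwich _ _ _ false) => N Ncons.
  (* Now the model of [T] comes first in the sandwich: its values of sentences starting with suprema
     are at most those in [N], and negation turns this into the comparison that
     [ultrapower_sandwich] expects. *)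
  have [M MT Mle] := @model_below _ _ true n T N hn Ncons.
  have [|I [U [S]]] := @ultrapower_sandwich _ _ n M N hn.
    move=> sigma alt.
    have [phi altphi phiE] := alternating_neg alt.
    have [tau alttau tauE] := alternating_sentence hn altphi.
    have value_tau A : value A tau = 1 - value A sigma.
      by apply: tauE => s; rewrite phiE (value_eval _ s).
    by have := Mle tau alttau; rewrite !value_tau; lra.
  by apply/models_ultrapower; exact: pres S MT.
Qed.
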